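(* For every mixed fair division instance $([n],[m],\mathcal{V})$ with symmetric tri-valued normalized valuations (that is, $v_i(o)\in\{-1,0,1\}$ for every agent $i$ and item $o$, the valuations are additive, and the instance is normalized), an EQ1 complete allocation exists, and one can be computed in polynomial time.
   Context: A (mixed) fair division instance $([n],[m],\mathcal{V})$ consists of $n$ agents, a set $O=[m]$ of $m$ indivisible items, and valuations $\mathcal{V}=\{v_1,\dots,v_n\}$ with $v_i:2^{[m]}\to\mathbb{Z}$ additive: $v_i(S)=\sum_{o\in S}v_i(o)$. A (complete) allocation $A=(A_1,\dots,A_n)$ is a partition of the set of all items into $n$ (possibly empty) bundles, $A_i$ going to agent $i$. An instance is normalized if $v_i(O)$ is the same constant for all agents $i$. An allocation $A$ is EQ1 (equitable up to one item) if for every pair of agents $i,j$ with $v_i(A_i)<v_j(A_j)$, either there exists $g\in A_j$ with $v_j(g)\ge 0$ such that $v_i(A_i)\ge v_j(A_j\setminus\{g\})$, or there exists $c\in A_i$ with $v_i(c)\le 0$ such that $v_i(A_i\setminus\{c\})\ge v_j(A_j)$. *)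

(* Defs.v *)
From HB Require Import structures.
From mathcomp Require Import all_boot all_order all_algebra.

Set Implicit Arguments.
Unset Strict Implicit.
Unset Printing Implicit Defensive.

Import Order.TTheory GRing.Theory Num.Theory.
Local Open Scope ring_scope.

Record instance := Instance {
  agents : nat;
  items : nat;
  valuation : 'I_agents -> {set 'I_items} -> int }.

(* Bundles are indexed by agents and may be empty. *)
Definition bundles (I : instance) := {ffun 'I_(agents I) -> {set 'I_(items I)}}.

Definition additive_valuations (I : instance) : Prop :=
  forall i S, valuation i S = \sum_(o in S) @valuation I i [set o].

Definition symmetric_trivalued (I : instance) : Prop :=
  forall i o, @valuation I i [set o] \in [:: -1; 0; 1].

Definition normalized (I : instance) : Prop :=
  exists c : int, forall i, @valuation I i [set: _] = c.

Definition complete_allocation (I : instance) (A : bundles I) : Prop :=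
  (forall i j, i != j -> [disjoint A i & A j]) /\ \bigcup_i A i = [set: _].

Definition EQ1 (I : instance) (A : bundles I) : Prop :=
  let v := @valuation I in
  forall i j, v i (A i) < v j (A j) ->
    (exists g, [/\ g \in A j, 0 <= v j [set g]
                 & v j (A j :\ g) <= v i (A i)]) \/
    (exists c, [/\ c \in A i, v i [set c] <= 0
                 & v j (A j) <= v i (A i :\ c)]).

(* Computation model: a random access machine on integers, presented with
   structured control flow.  It has a read-only input, a memory initialised
   to 0 and an append-only output.  The only arithmetic is addition and
   subtraction, so a computation of t steps creates integers of O(t) more bits
   than those it is given, and unit cost is polynomially equivalent to
   Turing-machine time. *)

Inductive expr :=
  | Const of int
  | Input of expr
  | Fetch of expr
  | Plus of expr & expr
  | Minus of expr & expr.

Inductive program :=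
  | Skip
  | Store of expr & expr
  | Write of expr
  | Seq of program & program
  | IfLe of expr & expr & program & program
  | WhileLe of expr & expr & program.

Definition memory := nat -> int.

Definition update (s : memory) (a : nat) (x : int) : memory :=
  fun b => if b == a then x else s b.

(* An integer used as an address stands for its absolute value; input cells
   beyond the end of the input read as 0. *)
Fixpoint eval (inp : seq int) (s : memory) (e : expr) : int :=
  match e with
  | Const z => z
  | Input e1 => inp`_(absz (eval inp s e1))
  | Fetch e1 => s (absz (eval inp s e1))
  | Plus e1 e2 => eval inp s e1 + eval inp s e2
  | Minus e1 e2 => eval inp s e1 - eval inp s e2
  end.

Fixpoint cost (e : expr) : nat :=
  match e with
  | Const _ => 1%N
  | Input e1 | Fetch e1 => (cost e1).+1
  | Plus e1 e2 | Minus e1 e2 => (cost e1 + cost e2).+1%N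
  end.

(* [exec inp c s t s' out]: on input inp, started in memory s, the program c
   halts after t steps in memory s', having written out. *)
Inductive exec (inp : seq int) :
    program -> memory -> nat -> memory -> seq int -> Prop :=
  | ExecSkip s : exec inp Skip s 1%N s [::]
  | ExecStore s a e :
      exec inp (Store a e) s (cost a + cost e).+1%N
        (update s (absz (eval inp s a)) (eval inp s e)) [::]
  | ExecWrite s e :
      exec inp (Write e) s (cost e).+1 s [:: eval inp s e]
  | ExecSeq c1 c2 s s1 s2 t1 t2 out1 out2 :
      exec inp c1 s t1 s1 out1 -> exec inp c2 s1 t2 s2 out2 ->
      exec inp (Seq c1 c2) s (t1 + t2)%N s2 (out1 ++ out2)
  | ExecIfTrue e1 e2 c1 c2 s s' t out :
      eval inp s e1 <= eval inp s e2 -> exec inp c1 s t s' out ->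
      exec inp (IfLe e1 e2 c1 c2) s (cost e1 + cost e2 + t).+1%N s' out
  | ExecIfFalse e1 e2 c1 c2 s s' t out :
      eval inp s e2 < eval inp s e1 -> exec inp c2 s t s' out ->
      exec inp (IfLe e1 e2 c1 c2) s (cost e1 + cost e2 + t).+1%N s' out
  | ExecWhileDone e1 e2 c s :
      eval inp s e2 < eval inp s e1 ->
      exec inp (WhileLe e1 e2 c) s (cost e1 + cost e2).+1%N s [::]
  | ExecWhileStep e1 e2 c s s1 s2 t1 t2 out1 out2 :
      eval inp s e1 <= eval inp s e2 ->
      exec inp c s t1 s1 out1 ->
      exec inp (WhileLe e1 e2 c) s1 t2 s2 out2 ->
      exec inp (WhileLe e1 e2 c) s (cost e1 + cost e2 + t1 + t2).+1%N s2
        (out1 ++ out2).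

Definition bit_size (w : seq int) : nat :=
  (\sum_(z <- w) (trunc_log 2 (absz z)).+1)%N.

(* The search problem "given x in D, find y with R x y" is solved by a single
   program, in time polynomial in the bit length of the encoding of x. *)
Definition poly_time_solvable (X : Type) (Y : X -> Type) (D : X -> Prop)
    (encX : X -> seq int) (encY : forall x, Y x -> seq int)
    (R : forall x, Y x -> Prop) : Prop :=
  exists (c : program) (p : {poly nat}), forall x, D x ->
    exists (y : Y x) (t : nat) (s : memory),
      [/\ R x y, exec (encX x) c (fun=> 0) t s (encY x y)
        & (t <= p.[bit_size (encX x)])%N].

Definition encode_instance (I : instance) : seq int :=
  [:: Posz (agents I), Posz (items I)
    & [seq @valuation I i [set o] | i <- enum 'I_(agents I),
                                    o <- enum 'I_(items I)]].

(* The incidence matrix of the bundles, row by row. *)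
Definition encode_bundles (I : instance) (A : bundles I) : seq int :=
  [seq Posz (o \in A i) | i <- enum 'I_(agents I), o <- enum 'I_(items I)].

(* Main.v *)
Require Import Defs.
From HB Require Import structures.
From mathcomp Require Import all_boot all_order all_algebra.
From mathcomp Require Import zify.

(* Since values lie in {-1, 0, 1}, EQ1 just says that all bundles are worth b or
   b + 1 for a common b, and this is invariant under negating the valuations,
   so the common value c of the whole set may be taken nonnegative.

   Hand the items out of a pool, keeping every agent's worth in {0, 1}.  The
   pool is treated as one more agent, who values every item at -1.  Call an
   agent of worth 0 reached when it can give up one unit of worth, along a chain of
   transfers leaving the intermediate agents unchanged, so that finally an item
   leaves the pool.  As soon as a reached agent can gain a unit at no harm
   to {0, 1}, pull along its chain; besides, an agent of worth 1 may waste an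
   item on a reached agent who is indifferent to it.  Suppose that nothing of
   this is possible and that some agent s is reached.  Comparing item by item, s
   values a reached agent's bundle no more than its owner does and any other
   bundle at most 0, so that c is at most the (negative) worth of the pool, a
   contradiction.  Hence, unless the pool is empty, no agent is reached, which
   forces all agents to have worth 1 and all items left in the pool to be worth
   1 to everybody: a round robin finishes. *)

Set Implicit Arguments.
Unset Strict Implicit.
Unset Printing Implicit Defensive.

Import Order.TTheory GRing.Theory Num.Theory.

(** * Exchanges *)

Definition upd T (f : nat -> T) (a : nat) (x : T) : nat -> T :=
  fun b => if b == a then x else f b.

Section Exchange.
Local Open Scope ring_scope.

Variables (n m : nat) (V : nat -> nat -> int).
Hypothesis V_bound : forall i o, (i < n)%N -> (o < m)%N -> -1 <= V i o <= 1.
(* Agent [n] is the pool. *)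
Hypothesis V_pool : forall o, (o < m)%N -> V n o = -1.

Definition worth (own : nat -> nat) (i : nat) : int :=
  \sum_(o < m | own o == i) V i o.

(* Agent [i] is reached when [stamp n <= stamp i]; raising [stamp n] above all
   other stamps thus resets the search.  The chain of a reached agent [i] starts
   by moving item [via i] between [i] and [par i]. *)
Record state := State {
  own : nat -> nat; lvl : nat -> int; stamp : nat -> nat;
  par : nat -> nat; via : nat -> nat; clock : nat }.

(** In both cases moving [q] to the other party carries one unit of worth from [z] to its parent.
    Stamps strictly decrease towards the parent, so a chain cannot run in circles. *)
Definition edge (st : state) (ow : nat -> nat) (z : nat) : Prop :=
  let p := par st z in let q := via st z in
  [/\ (p <= n)%N, (stamp st n <= stamp st p < stamp st z)%N, (q < m)%N
    & (ow q = z /\ V z q = 1 /\ V p q = 1) \/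
      (ow q = p /\ V z q = -1 /\ V p q = -1)].

Definition pool (ow : nat -> nat) : nat := (\sum_(o < m) (ow o == n))%N.
Definition ones (w : nat -> int) : nat := (\sum_(i < n) (w i == 1))%N.
Definition unreached (s : nat -> nat) : nat := (\sum_(i < n) (s i < s n))%N.
(* Each tick of the clock lowers the potential: an item leaves the pool and at
   most one more agent gets worth 1, or an agent of worth 1 drops to 0, or an
   agent becomes reached. *)
Definition potential (st : state) : nat :=
  (pool (own st) * (n + 2) ^ 2 + ones (lvl st) * (n + 2)
   + unreached (stamp st))%N.
(** At the start the clock shows 1, the pool holds [m] items, nobody has worth 1 and at most [n]
    agents are unreached. As clock plus potential never grows, this bounds every later clock
    reading. *)
Definition budget : nat := (m * (n + 2) ^ 2 + n + 1)%N.

Record inv (st : state) : Prop := Inv {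
  inv_own : forall o, (o < m)%N -> (own st o <= n)%N;
  inv_lvl : forall i, (i < n)%N -> lvl st i = worth (own st) i;
  inv_01 : forall i, (i < n)%N -> 0 <= lvl st i <= 1;
  inv_tree : forall z, (z < n)%N -> (stamp st n <= stamp st z)%N ->
    lvl st z = 0 /\ edge st (own st) z;
  inv_clock : forall i, (i <= n)%N -> (stamp st i <= clock st)%N;
  inv_potential : (clock st + potential st <= budget)%N }.

(* The effect of giving item [o] to [x] is described by a triple [(g, h, t)]:
   the reached agent [g] gains one unit, which its chain carries on to the pool,
   and the other party [h] ends up with worth [t].  In the third case an item is
   wasted on [x], and [g] is the pool because no chain is needed; [t = 2] means
   that the move is useless. *)
Definition decide (st : state) (o x : nat) : nat * nat * int :=
  let a := own st o in
  if (stamp st n <= stamp st a)%N && (V a o <= -1) then (a, x, lvl st x + V x o)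
  else if (stamp st n <= stamp st x)%N then
    if 1 <= V x o then (x, a, lvl st a - V a o)
    else if [&& 0 <= V x o, 1 <= V a o & 1 <= lvl st a] then (n, a, 0)
    else (n, n, 2%:Z)
  else (n, n, 2%:Z).

(* A surplus unit, now held by [g], is being passed on to the pool along the
   chain of [g]: only the edges still ahead are required to be intact. *)
Record walking (st : state) (target : nat -> int) (ow : nat -> nat) (g : nat) :
    Prop := Walking {
  walk_le : (g <= n)%N;
  walk_in : (stamp st n <= stamp st g)%N;
  walk_own : forall o, (o < m)%N -> (ow o <= n)%N;
  walk_worth : forall i, (i <= n)%N -> worth ow i = target i + (i == g)%:Z;
  walk_edge : forall z, (z < n)%N ->
    (stamp st n <= stamp st z <= stamp st g)%N ->
    edge st ow z }.

Lemma worth_upd ow q b i : (q < m)%N -> ow q != b ->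
  worth (upd ow q b) i =
    worth ow i - (if i == ow q then V i q else 0) +
    (if i == b then V i q else 0).
Proof.
move=> qm ab; rewrite /worth big_mkcond [in RHS]big_mkcond /=.
rewrite (bigD1 (Ordinal qm)) //= [in RHS](bigD1 (Ordinal qm)) //=.
rewrite {1}/upd eqxx [b == i]eq_sym [ow q == i]eq_sym.
rewrite (eq_bigr (fun o : 'I_m => if ow o == i then V i o else 0)); last first.
  by move=> o; rewrite -(inj_eq val_inj) /= /upd => /negbTE->.
case: (i =P ow q); case: (i =P b) => *; lia.
Qed.

Lemma worth_pool ow : worth ow n = - (pool ow)%:Z.
Proof.
rewrite /worth /pool big_mkcond /= -natz natr_sum -sumrN; apply: eq_bigr => o _.
by case: eqP => _; rewrite ?oppr0 // V_pool.
Qed.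

(** Either form of the edge shifts the surplus unit from [g] to its parent; what needs care is that
    the edges still ahead stay intact. *)
Lemma walk_step st target ow g : walking st target ow g -> (g < n)%N ->
  let q := via st g in let p := par st g in
  [/\ (ow q = g \/ ow q = p),
      (stamp st p < stamp st g)%N
    & walking st target (upd ow q (g + p - ow q)%N) p].
Proof.
move=> [gn ing ow_le val_ow edges] g_lt q p.
have := edges g g_lt; rewrite ing leqnn => /(_ isT).
rewrite /edge -/p -/q => -[pn /andP[inp pg] qm owq].
split=> //; first by case: owq => -[]; [left|right].
have np : g <> p by move=> e; rewrite -e ltnn in pg.
split=> // [o om|i i_n|z zn /andP[inz zp]].
- rewrite /upd; case: eqP => _; last exact: ow_le.
  by case: owq => -[->]; lia.
- rewrite worth_upd //; last by apply/eqP; case: owq => -[-> _]; lia.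
  rewrite val_ow //.
  case: owq => -[-> [Vg Vp]].
    have -> : (g + p - g)%N = p by lia.
    by case: eqP => [->|_]; case: eqP => [e|_]; rewrite ?e ?Vg ?Vp; lia.
  have -> : (g + p - p)%N = g by lia.
  by case: eqP => [->|_]; case: eqP => [e|_]; rewrite ?e ?Vg ?Vp; lia.
- have := edges z zn; rewrite inz (leq_trans zp (ltnW pg)) => /(_ isT).
  rewrite /edge => -[-> -> -> /= owz]; split=> //; move: owz.
  rewrite /upd; case: eqP => // ->.
  have [inpz zpz] : (stamp st n <= stamp st (par st z))%N /\
    (stamp st (par st z) < stamp st z)%N.
    have := edges z zn; rewrite inz (leq_trans zp (ltnW pg)) => /(_ isT).
    by case=> _ /andP[].
  (* An edge ahead cannot use the moved item: three of the four combinations contradict the order of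
     the stamps, and in the other one [p] would value the item at both -1 and 1. *)
  case: owq => -[-> [Vg Vp]] [[e [V1 V2]]|[e [V1 V2]]].
  + by move: zp pg; rewrite -e; lia.
  + by move: zp pg; rewrite e; lia.
  + by move: Vp; rewrite e V1.
  + by move: zpz zp; rewrite -e; lia.
Qed.

(** The pool is to end with worth [r + 1]: one item fewer after a move along a chain, the same
    number after a wasted item, where [h] drops from 1 to 0 instead. *)
Lemma decide_win st o x g h t : inv st -> (o < m)%N -> (x < n)%N ->
  decide st o x = (g, h, t) -> 0 <= t <= 1 ->
  (h < n)%N /\ exists r,
    walking st (fun i => if i == n then r else upd (lvl st) h t i)
      (upd (own st) o x) g /\
    (r = worth (own st) n \/
     [/\ r = worth (own st) n - 1, lvl st h = 1 & t = 0]).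
Proof.
move=> [own_le lvlE lvl01 tree _ _] om xn.
rewrite /decide; set a := own st o.
have an : (a <= n)%N := own_le o om.
have own_upd_le b q : (b <= n)%N -> (q < m)%N -> (upd (own st) o b q <= n)%N.
  by rewrite /upd => bn /own_le; case: eqP.
have edge_upd z : edge st (own st) z -> via st z <> o ->
    edge st (upd (own st) o x) z.
  by rewrite /edge /upd => -[? ? ?]; case: eqP.
have worthE i : a <> x -> (i < n)%N -> worth (upd (own st) o x) i =
    lvl st i - (if i == a then V i o else 0) + (if i == x then V i o else 0).
  by move=> ax i_n; rewrite worth_upd ?lvlE //; apply/eqP.
have worthEn : a <> x -> worth (upd (own st) o x) n =
    worth (own st) n - (if n == a then -1 else 0).
  move=> ax; rewrite worth_upd //; last exact/eqP.
  by rewrite V_pool // [n == x]gtn_eqF // addr0.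
case: ifP => [/andP[ina Va] [<- <- <-] t01|notA].
  have Va1 : V a o = -1.
    move: an; rewrite leq_eqVlt => /orP[/eqP->|an1]; first exact: V_pool.
    have := V_bound an1 om; lia.
  have ax : a <> x.
    move=> e; rewrite -{}e in xn t01.
    by have [l0 _] := tree a xn ina; rewrite l0 Va1 in t01.
  split=> //; exists (worth (own st) n); split; last by left.
  split=> // [q|i|z zn /andP[inz za]]; first by apply: own_upd_le; exact: ltnW.
    rewrite leq_eqVlt => /orP[/eqP->|i_n].
      rewrite worthEn // eqxx; case: eqP => //; lia.
    rewrite worthE // (ltn_eqF i_n) /upd.
    by case: (i =P x) => [->|ix]; case: eqP => [e|ne]; rewrite ?e ?Va1; lia.
  (* If an edge ahead used [o], the owner [a] would be its child, valuing [o] at 1 against [Va1], or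
     its parent, with a stamp below that of [z], against [za]. *)
  have [_ ez] := tree z zn inz; apply: edge_upd => // e.
  case: ez => _; rewrite e -/a => /andP[_ pz] _ [[e' [Vz _]]|[e' _]].
    by rewrite e' Vz in Va1.
  by move: pz za; rewrite -e'; lia.
case: ifP => // inx; last by case=> _ _ <-.
have [lx0 _] := tree x xn inx.
have an1 : (a < n)%N.
  rewrite ltn_neqAle an andbT; apply/eqP => e.
  by rewrite e leqnn V_pool in notA.
have Vab := V_bound an1 om; have Vxb := V_bound xn om.
case: ifP => Vx.
  case=> <- <- <- t01.
  have Vx1 : V x o = 1 by lia.
  have ax : a <> x by move=> e; rewrite e lx0 Vx1 in t01.
  split=> //; exists (worth (own st) n); split; last by left.
  split=> // [|q|i|z zn /andP[inz zx]]; first exact: ltnW.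
  - by apply: own_upd_le; exact: ltnW.
  - rewrite leq_eqVlt => /orP[/eqP->|i_n].
      by rewrite worthEn // eqxx (gtn_eqF an1) (gtn_eqF xn) subr0.
    rewrite worthE // (ltn_eqF i_n) /upd.
    by case: (i =P x) => [->|ix]; case: eqP => [e|ne]; rewrite ?e ?Vx1; lia.
  (* If the edge of [z] used [o], then either [a = z] and [t] would be -1, or [a] would be a reached
     owner valuing [o] at -1, which the first case of [decide] has caught. *)
  have [lz0 ez] := tree z zn inz; apply: edge_upd => // e.
  case: ez => _; rewrite e -/a => /andP[inpz pz] _ [[e' [Vz _]]|[e' [_ Vp]]].
    by rewrite e' lz0 Vz in t01.
  by rewrite e' inpz Vp in notA.
case: ifP => [/and3P[Vx0 Va la] [<- <- <-] _|_ [_ _ <-]] //.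
have lab := lvl01 a an1.
have [Va1 Vx1 la1] : [/\ V a o = 1, V x o = 0 & lvl st a = 1] by split; lia.
have ax : a <> x by move=> e; rewrite e lx0 in la1.
split=> //; exists (worth (own st) n - 1); split; last by right.
split=> // [q|i|z zn /andP[inz zx]].
- by apply: own_upd_le; exact: ltnW.
- rewrite leq_eqVlt => /orP[/eqP->|i_n].
    by rewrite worthEn // eqxx (gtn_eqF an1); lia.
  rewrite worthE // (ltn_eqF i_n) /upd.
  by case: (i =P x) => [->|ix]; case: eqP => [e|ne]; rewrite ?e ?Vx1 ?Va1 ?la1;
    lia.
have [lz0 [_ /andP[inpz pz] _ _]] := tree z zn inz; lia.
Qed.

Lemma pool_le ow : (pool ow <= m)%N.
Proof.
rewrite /pool -[leqRHS]card_ord -sum1_card.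
by apply: leq_sum => o _; case: eqP.
Qed.

Lemma unreached_le s : (unreached s <= n)%N.
Proof.
rewrite /unreached -[leqRHS]card_ord -sum1_card.
by apply: leq_sum => o _; case: (_ < _)%N.
Qed.

Lemma ones_upd w h t : (h < n)%N ->
  (ones (upd w h t) + (w h == 1) = ones w + (t == 1))%N.
Proof.
move=> hn; rewrite /ones (bigD1 (Ordinal hn)) //= [in RHS](bigD1 (Ordinal hn))
  //=.
rewrite {1}/upd eqxx.
rewrite (eq_bigr (fun i : 'I_n => (w i == 1) : nat));
  first by rewrite addnC addnCA addnC.
by move=> i; rewrite -(inj_eq val_inj) /= /upd => /negbTE->.
Qed.

(** The new stamp of the pool exceeds all others, which empties the search tree; the drop in the
    potential has to pay for this reset. *)
Lemma walk_end st ow h t r : inv st -> (h < n)%N -> 0 <= t <= 1 ->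
  (r = worth (own st) n \/
     [/\ r = worth (own st) n - 1, lvl st h = 1 & t = 0]) ->
  walking st (fun i => if i == n then r else upd (lvl st) h t i) ow n ->
  inv (State ow (upd (lvl st) h t) (upd (stamp st) n (clock st).+1)
         (par st) (via st) (clock st).+1).
Proof.
move=> [own_le lvlE lvl01 tree clk pot] hn t01 r_spec [_ _ ow_le val_ow _].
have lvl_ow i : (i < n)%N -> upd (lvl st) h t i = worth ow i.
  by move=> i_n; rewrite val_ow ?(ltnW i_n) // ltn_eqF // addr0.
split=> //= [i i_n|z zn|i i_n|].
- by rewrite /upd; case: eqP => _; rewrite ?lvl01.
- by rewrite /upd eqxx ltn_eqF // leqNgt ltnS clk // ltnW.
- by rewrite /upd; case: eqP => // _; rewrite ltnW // ltnS clk.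
have U := unreached_le (upd (stamp st) n (clock st).+1).
have O := ones_upd (lvl st) t hn.
have := val_ow n (leqnn n); rewrite eqxx => W.
move: r_spec W pot; rewrite !worth_pool /potential /=.
set P := pool ow; set P' := pool (own st) => r_spec W pot.
have : (P.+1 = P' \/ P = P' /\ (ones (upd (lvl st) h t)).+1 = ones (lvl st))%N.
  case: r_spec => [e|[e l0 t0]]; first by left; lia.
  by right; split; [lia | move: O; rewrite l0 t0; lia].
have : (ones (upd (lvl st) h t) <= (ones (lvl st)).+1)%N by lia.
move: pot U; move: (ones _) (ones _) (unreached _) (unreached _) => a b c d.
(* An item leaving the pool frees [(n + 2) ^ 2], enough for one more agent of worth 1, for up to [n]
   agents becoming unreached and for the tick. An agent dropping from 1 to 0 frees [n + 2], enough
   for the last two. *)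
have : (2 * (n + 2) <= (n + 2) ^ 2)%N by rewrite -mulnn leq_mul2r; lia.
move: (_ ^ 2)%N => Q leQ pot U leab [e|[e leb]].
  have : (a * (n + 2) <= b.+1 * (n + 2))%N by rewrite leq_mul2r leab orbT.
  by move: pot; rewrite -e !mulSn; lia.
by move: pot; rewrite -e -leb !mulSn; lia.
Qed.

(** A negative [t] is -1, so [h] has worth 0 and moving [o] would carry a unit from [h] to the
    reached [g]: this is an edge by which [h] joins the tree. No older edge has [h] as an endpoint,
    so its stamp may change. *)
Lemma decide_grow st o x g h t : inv st -> (o < m)%N -> (x < n)%N ->
  decide st o x = (g, h, t) -> t < 0 -> (stamp st h < stamp st n)%N ->
  inv (State (own st) (lvl st) (upd (stamp st) h (clock st).+1)
         (upd (par st) h g) (upd (via st) h o) (clock st).+1).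
Proof.
move=> [own_le lvlE lvl01 tree clk pot] om xn dec tlt0 outh.
have [hn lh0 [gn ing] e] : [/\ (h < n)%N, lvl st h = 0, (g <= n)%N /\
    (stamp st n <= stamp st g)%N &
    (own st o = h /\ V h o = 1 /\ V g o = 1) \/
    (own st o = g /\ V h o = -1 /\ V g o = -1)].
  move: dec; rewrite /decide; set a := own st o.
  have an : (a <= n)%N := own_le o om.
  have Vxb := V_bound xn om; have lx := lvl01 x xn.
  have Vab : -1 <= V a o <= 1.
    by move: an; rewrite leq_eqVlt => /orP[/eqP->|an1];
      rewrite ?V_pool ?V_bound.
  case: ifP => [/andP[ina Va] [<- eh et]|notA].
    rewrite -{}eh -{}et in outh tlt0 *; split=> //; [lia|right].
    by split=> //; split; lia.
  case: ifP => // inx; last by case=> _ _ et; rewrite -et in tlt0.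
  have an1 : (a < n)%N.
    rewrite ltn_neqAle an andbT; apply/eqP => e.
    by rewrite e leqnn V_pool in notA.
  have la := lvl01 a an1.
  case: ifP => Vx.
    case=> <- eh et; rewrite -{}eh -{}et in outh tlt0 *.
    split=> //; [lia|by split=> //; exact: ltnW|left].
    by split=> //; split; lia.
  by case: ifP => _ [_ _ et]; rewrite -et in tlt0.
have hNn : (n == h) = false by rewrite gtn_eqF.
have gh : (g == h) = false by apply/eqP => E; rewrite E leqNgt outh in ing.
split=> //= [z zn|i i_n|].
- rewrite {1}/upd hNn; rewrite {1}/upd; case: (z =P h) => [->|zh] inz.
    split=> //; rewrite /edge /upd /= eqxx hNn gh; split=> //.
    by rewrite ing ltnS clk.
  have [l0 [pn /andP[inp pz] vm ez]] := tree z zn inz; split=> //.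
  rewrite /edge /upd /= hNn; move/eqP/negbTE: zh => zh; rewrite !zh.
  have -> : (par st z == h) = false.
    by apply/eqP => E; rewrite E leqNgt outh in inp.
  by split=> //; rewrite inp.
- by rewrite /upd; case: eqP => // _; rewrite ltnW // ltnS clk.
have : ((unreached (upd (stamp st) h (clock st).+1)).+1 = unreached (stamp
  st))%N.
  rewrite /unreached (bigD1 (Ordinal hn)) //= [in RHS](bigD1 (Ordinal hn)) //=.
  rewrite outh add1n {1 2}/upd eqxx hNn ltnNge leqW ?clk //= add0n.
  congr S; apply: eq_bigr => i; rewrite -(inj_eq val_inj) /= /upd => /negbTE->.
  by rewrite hNn.
by move: pot; rewrite /potential /=; lia.
Qed.

(** Either the other party would rise above 1 (the marker 2 counts as such), or the pair only leads
    to an agent reached already. *)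
Definition quiet (st : state) (o x : nat) : bool :=
  let: (g, h, t) := decide st o x in
  (1 < t) || ((t < 0) && (stamp st n <= stamp st h)%N).

(** If some [s] were reached, summing its values bundle by bundle would bound [c] by the worth of
    the pool, which is negative because of [o0]. *)
Lemma quiet_universal st (c : int) : inv st -> 0 <= c ->
  (forall i, (i < n)%N -> \sum_(o < m) V i o = c) ->
  (forall o x, (o < m)%N -> (x < n)%N -> quiet st o x) ->
  forall o i, (o < m)%N -> own st o = n -> (i < n)%N ->
  lvl st i = 1 /\ V i o = 1.
Proof.
move=> [own_le lvlE lvl01 tree _ _] c_ge0 total qt o0 i om0 own0 i_n.
have out s : (s < n)%N -> (stamp st s < stamp st n)%N.
  move=> sn; rewrite ltnNge; apply/negP => ins.
  have [ls0 _] := tree s sn ins.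
  suff bundle a : (a <= n)%N -> \sum_(o < m | own st o == a) V s o <=
      if a == n then worth (own st) n else 0.
    suff : c <= worth (own st) n.
      rewrite worth_pool /pool (bigD1 (Ordinal om0)) //= own0 eqxx; lia.
    rewrite -(total s sn).
    rewrite (partition_big (fun o : 'I_m =>
      inord (own st o) : 'I_n.+1) xpredT) //=.
    rewrite big_ord_recr /= -[leRHS]add0r; apply: lerD.
      apply: sumr_le0 => a _.
      rewrite (eq_bigl (fun o : 'I_m => own st o == a)).
        by have := bundle a (ltnW (ltn_ord a)); rewrite ltn_eqF.
      by move=> o; rewrite -(inj_eq val_inj) /= inordK // ltnS own_le.
    rewrite (eq_bigl (fun o : 'I_m => own st o == n)).
      by have := bundle n (leqnn n); rewrite eqxx.
    by move=> o; rewrite -(inj_eq val_inj) /= inordK // ltnS own_le.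
  move=> an.
  have Vsb (o : 'I_m) : -1 <= V s o <= 1 by exact: V_bound.
  have Vab (o : 'I_m) : -1 <= V a o <= 1.
    by move: an; rewrite leq_eqVlt => /orP[/eqP->|an1];
      rewrite ?V_pool ?V_bound.
  have la : (a < n)%N -> 0 <= lvl st a <= 1 by exact: lvl01.
  (* For a reached owner quietness yields [V s o <= V a o] item by item, and such an owner has worth
     0 unless it is the pool. *)
  case: (leqP (stamp st n) (stamp st a)) => ina.
    have -> : (if a == n then worth (own st) n else 0) = worth (own st) a.
      case: eqP => [->//|/eqP ne];
        have an1 : (a < n)%N by rewrite ltn_neqAle ne.
      by rewrite -lvlE //; have [] := tree a an1 ina.
    apply: ler_sum => o /eqP owno.
    have := qt o s (ltn_ord o) sn; rewrite /quiet /decide owno ina ins ls0 /=.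
    have [E|[l0 _]] : a = n \/ lvl st a = 0 /\ (a < n)%N.
      move: an; rewrite leq_eqVlt => /orP[/eqP|p]; [by left|right].
      by have [] := tree a p ina.
      by rewrite E V_pool //=; have := Vsb o; lia.
    rewrite l0; have := Vsb o; have := Vab o.
    by do ?[case: ifP => ?] => /=; lia.
  have an1 : (a < n)%N.
    by rewrite ltn_neqAle an andbT; apply/eqP => E; rewrite E ltnn in ina.
  rewrite ltn_eqF //.
  (* For an unreached owner of worth 0 quietness excludes [V s o = 1]. For one of worth 1 it yields
     [V s o <= - V a o], so [s] values the bundle at most -1. *)
  have [l0|l1] : lvl st a = 0 \/ lvl st a = 1 by have := la an1; lia.
    apply: sumr_le0 => o /eqP owno.
    have := qt o s (ltn_ord o) sn;
      rewrite /quiet /decide owno leqNgt ina ins l0 /=.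
    by have := Vsb o; have := Vab o; do ?[case: ifP => ?] => /=; lia.
  apply: (@le_trans _ _ (- worth (own st) a)); last by rewrite -lvlE // l1.
  rewrite -sumrN; apply: ler_sum => o /eqP owno.
  have := qt o s (ltn_ord o) sn;
    rewrite /quiet /decide owno leqNgt ina ins l1 /=.
  by have := Vsb o; have := Vab o; do ?[case: ifP => ?] => /=; lia.
(* With nobody reached and the pool as owner, quietness leaves only [lvl st i + V i o0 = 2]. *)
have := qt o0 i om0 i_n; rewrite /quiet /decide own0 V_pool // leqnn /=.
have := out i i_n; rewrite ltnNge => /negbTE ->.
by have := lvl01 i i_n; have := V_bound i_n om0; lia.
Qed.

(* Invariant of the final round robin: [x] is the next agent to be served, and
   the items before [k] have left the pool. *)
Record filling (ow : nat -> nat) (k x : nat) : Prop := Filling {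
  fill_le : forall o, (o < m)%N -> (ow o <= n)%N;
  fill_done : forall o, (o < k)%N -> (ow o < n)%N;
  fill_good : forall o i, (o < m)%N -> ow o = n -> (i < n)%N -> V i o = 1;
  fill_balanced : exists b, forall i, (i < n)%N -> b <= worth ow i <= b + 1;
  fill_sharp : forall o, (o < m)%N -> ow o = n ->
    exists b, forall i, (i < n)%N -> worth ow i = b + (i < x)%N%:Z }.

(** If items are left, all agents have worth 1, the sharp form with [b = 1]. If the pool is empty,
    worths are only known to be 0 or 1, and the sharp form is vacuous. *)
Lemma filling_start st (c : int) : inv st -> 0 <= c ->
  (forall i, (i < n)%N -> \sum_(o < m) V i o = c) ->
  (forall o x, (o < m)%N -> (x < n)%N -> quiet st o x) ->
  filling (own st) 0 0.
Proof.
move=> I c0 total qt; have univ := quiet_universal I c0 total qt.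
split=> // [|o i om own_o i_n||o om own_o].
- exact: inv_own I.
- by have [] := univ o i om own_o i_n.
- by exists 0 => i i_n; rewrite -(inv_lvl I) // add0r (inv_01 I).
exists 1 => i i_n; rewrite -(inv_lvl I) //.
by have [-> _] := univ o i om own_o i_n.
Qed.

Lemma filling_skip ow k x : filling ow k x -> (ow k < n)%N -> filling ow k.+1 x.
Proof.
case=> le done good bal sharp owk; split=> // o.
by rewrite ltnS leq_eqVlt => /orP[/eqP->|/done].
Qed.

(** The item comes from the pool and is worth 1 to [x], so only the worth of [x] changes. Once the
    last agent has been served all are level at [b + 1], and the round restarts. *)
Lemma filling_give ow k x : filling ow k x -> (k < m)%N -> ow k = n ->
  (x < n)%N -> filling (upd ow k x) k.+1 (if (n <= x.+1)%N then 0 else x.+1)%N.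
Proof.
case=> le done good bal sharp km owk xn.
have updP o : upd ow k x o = n -> ow o = n.
  by rewrite /upd; case: eqP => // _ e; rewrite e ltnn in xn.
have [b bE] := sharp k km owk.
have worthE i : (i < n)%N ->
  worth (upd ow k x) i = b + (i < x)%N%:Z + (i == x)%:Z.
  move=> i_n; rewrite worth_upd //; last by rewrite owk gtn_eqF.
  rewrite owk (ltn_eqF i_n) subr0 bE //; congr (_ + _).
  by case: eqP => // e; rewrite good // owk.
split=> [o om|o|o i om /updP e||o om /updP e].
- by rewrite /upd; case: eqP => _; [exact: ltnW|exact: le].
- by rewrite ltnS leq_eqVlt /upd; case: eqP => //= _; exact: done.
- exact: good.
- exists b => i i_n; rewrite worthE //; case: ltngtP; lia.
case: leqP => nx.
  by exists (b + 1) => i i_n; rewrite worthE //; case: ltngtP; lia.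
by exists b => i i_n; rewrite worthE //; case: ltngtP; lia.
Qed.

End Exchange.

(** * Total correctness and running time of programs *)

Section Machine.
Local Open Scope ring_scope.

Variable inp : seq int.

Fixpoint loop_free (c : program) : bool :=
  match c with
  | Skip | Store _ _ => true
  | Seq c1 c2 | IfLe _ _ c1 c2 => loop_free c1 && loop_free c2
  | Write _ | WhileLe _ _ _ => false
  end.

(** Meaningful for [loop_free] programs only: the default branch is right for [Skip] and a dummy for
    writes and loops. *)
Fixpoint run (c : program) (s : memory) : memory :=
  match c with
  | Store a e => update s (absz (eval inp s a)) (eval inp s e)
  | Seq c1 c2 => run c2 (run c1 s)
  | IfLe e1 e2 c1 c2 =>
      if eval inp s e1 <= eval inp s e2 then run c1 s else run c2 s
  | _ => s
  end.

Fixpoint steps (c : program) : nat :=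
  match c with
  | Store a e => (cost a + cost e).+1%N
  | Seq c1 c2 => (steps c1 + steps c2)%N
  | IfLe e1 e2 c1 c2 => (cost e1 + cost e2 + maxn (steps c1) (steps c2)).+1%N
  | _ => 1%N
  end.

(** A total-correctness triple; time is bounded rather than exact so that branches of different
    length can share one bound. *)
Definition runs (c : program) (s : memory) (T : nat) (out : seq int)
    (Q : memory -> Prop) : Prop :=
  exists t s', [/\ exec inp c s t s' out, (t <= T)%N & Q s'].

Lemma runs_weaken c s T T' out (Q Q' : memory -> Prop) :
  runs c s T out Q -> (T <= T')%N -> (forall s', Q s' -> Q' s') ->
  runs c s T' out Q'.
Proof.
move=> [t [s' [ex tT q]]] TT' QQ'.
by exists t, s'; split; [|exact: leq_trans TT'|exact: QQ'].
Qed.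

Lemma runs_loop_free c s (Q : memory -> Prop) :
  loop_free c -> Q (run c s) -> runs c s (steps c) [::] Q.
Proof.
move=> lf Qs; suff [t [ex tT]] :
  exists t, exec inp c s t (run c s) [::] /\ (t <= steps c)%N.
  by exists t, (run c s).
elim: c lf s {Qs} => //=.
- by move=> _ s; exists 1%N; split => //; exact: ExecSkip.
- by move=> a e _ s; eexists; split; [exact: ExecStore|].
- move=> c1 IH1 c2 IH2 /andP[/IH1 {}IH1 /IH2 {}IH2] s.
  have [t1 [ex1 le1]] := IH1 s; have [t2 [ex2 le2]] := IH2 (run c1 s).
  exists (t1 + t2)%N; split; last exact: leq_add.
  by rewrite -[X in exec _ _ _ _ _ X]cats0; exact: ExecSeq ex1 ex2.
- move=> e1 e2 c1 IH1 c2 IH2 /andP[/IH1 {}IH1 /IH2 {}IH2] s.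
  case: leP => le12.
    have [t1 [ex1 le1]] := IH1 s.
    by eexists; split; [exact: ExecIfTrue ex1|]; lia.
  have [t2 [ex2 le2]] := IH2 s.
  by eexists; split; [exact: ExecIfFalse ex2|]; lia.
Qed.

Lemma runs_seq c1 c2 s T1 T2 out1 out2 (Q Q' : memory -> Prop) :
  runs c1 s T1 out1 Q -> (forall s1, Q s1 -> runs c2 s1 T2 out2 Q') ->
  runs (Seq c1 c2) s (T1 + T2)%N (out1 ++ out2) Q'.
Proof.
move=> [t1 [s1 [ex1 le1 q1]]] /(_ _ q1)[t2 [s2 [ex2 le2 q2]]].
by exists (t1 + t2)%N, s2; split; [exact: ExecSeq ex1 ex2|exact: leq_add|].
Qed.

Lemma runs_seq_silent c1 c2 s T1 T2 T (Q Q' : memory -> Prop) out :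
  (T1 + T2 <= T)%N -> runs c1 s T1 [::] Q ->
  (forall s1, Q s1 -> runs c2 s1 T2 out Q') -> runs (Seq c1 c2) s T out Q'.
Proof. by move=> leT r1 r2; apply: runs_weaken (runs_seq r1 r2) leT _. Qed.

Lemma runs_seq_then_silent c1 c2 s T1 T2 T out (Q Q' : memory -> Prop) :
  (T1 + T2 <= T)%N -> runs c1 s T1 out Q ->
  (forall s1, Q s1 -> runs c2 s1 T2 [::] Q') -> runs (Seq c1 c2) s T out Q'.
Proof.
move=> leT r1 r2; rewrite -[out]cats0.
by apply: runs_weaken (runs_seq r1 r2) leT _.
Qed.

Lemma runs_write e s T (Q : memory -> Prop) :
  (cost e < T)%N -> Q s -> runs (Write e) s T [:: eval inp s e] Q.
Proof. by exists (cost e).+1, s; split=> //; exact: ExecWrite. Qed.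

Lemma runs_if e1 e2 c1 c2 s T out (Q : memory -> Prop) :
  (eval inp s e1 <= eval inp s e2 -> runs c1 s T out Q) ->
  (eval inp s e2 < eval inp s e1 -> runs c2 s T out Q) ->
  runs (IfLe e1 e2 c1 c2) s (cost e1 + cost e2 + T).+1%N out Q.
Proof.
move=> H1 H2; case: (leP (eval inp s e1) (eval inp s e2)) => le12.
  have [t [s' [ex le q]]] := H1 le12.
  by eexists; eexists; split; [exact: ExecIfTrue ex| |exact: q]; lia.
have [t [s' [ex le q]]] := H2 le12.
by eexists; eexists; split; [exact: ExecIfFalse ex| |exact: q]; lia.
Qed.

Lemma runs_if_le e1 e2 c1 c2 s T T' out (Q : memory -> Prop) :
  (cost e1 + cost e2 + T < T')%N ->
  (eval inp s e1 <= eval inp s e2 -> runs c1 s T out Q) ->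
  (eval inp s e2 < eval inp s e1 -> runs c2 s T out Q) ->
  runs (IfLe e1 e2 c1 c2) s T' out Q.
Proof. by move=> TT' H1 H2; apply: runs_weaken (runs_if H1 H2) TT' _. Qed.

Lemma runs_loop_free_le c s T (Q : memory -> Prop) :
  loop_free c -> (steps c <= T)%N -> Q (run c s) -> runs c s T [::] Q.
Proof.
by move=> lf leT Qs; apply: runs_weaken (runs_loop_free lf Qs) leT _.
Qed.

(** The guard is tied to the counter only through the indexed invariant [J]; the factor [N.+1]
    includes the final, failing test. *)
Lemma runs_for e1 e2 c s N T (f : nat -> seq int) (J : nat -> memory -> Prop) :
  (forall k s, (k < N)%N -> J k s ->
     eval inp s e1 <= eval inp s e2 /\ runs c s T (f k) (J k.+1)) ->
  (forall s, J N s -> eval inp s e2 < eval inp s e1) ->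
  J 0%N s ->
  runs (WhileLe e1 e2 c) s (N.+1 * (cost e1 + cost e2 + T).+1)%N
    (flatten [seq f k | k <- iota 0 N]) (J N).
Proof.
move=> body stop J0.
suff gen d k s0 : (k + d = N)%N -> J k s0 ->
    runs (WhileLe e1 e2 c) s0 (d.+1 * (cost e1 + cost e2 + T).+1)%N
    (flatten [seq f k | k <- iota k d]) (J N) by exact: gen.
elim: d k s0 => [|d IH] k s0.
  rewrite addn0 /= => -> JN; exists (cost e1 + cost e2).+1, s0; split=> //.
    by apply: ExecWhileDone; exact: stop.
  by rewrite mul1n; lia.
rewrite addnS -addSn => kd Jk.
have [le12 [t1 [s1 [ex1 le1 J1]]]] := body k s0 ltac:(lia) Jk.
have [t2 [s2 [ex2 le2 J2]]] := IH _ _ kd J1.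
eexists; exists s2; split; [exact: ExecWhileStep ex1 ex2| |by []].
by rewrite mulSn; lia.
Qed.

(** The variant [mu] may drop by more than one; its initial value bounds the number of
    iterations. *)
Lemma runs_while e1 e2 c s T (mu : memory -> nat) (J : memory -> Prop) :
  (forall s, J s -> eval inp s e1 <= eval inp s e2 ->
     runs c s T [::] (fun s' => J s' /\ (mu s' < mu s)%N)) ->
  J s ->
  runs (WhileLe e1 e2 c) s ((mu s).+1 * (cost e1 + cost e2 + T).+1)%N [::]
    (fun s' => J s' /\ eval inp s' e2 < eval inp s' e1).
Proof.
move=> body; have [k] := ubnP (mu s); elim: k s => // k IH s muk Js.
case: (leP (eval inp s e1) (eval inp s e2)) => le12; last first.
  exists (cost e1 + cost e2).+1, s; split=> //; first exact: ExecWhileDone.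
  by rewrite mulSn; lia.
have [t1 [s1 [ex1 le1 [J1 mu1]]]] := body s Js le12.
have [t2 [s2 [ex2 le2 J2]]] := IH s1 ltac:(lia) J1.
eexists; exists s2; split; [exact: ExecWhileStep ex1 ex2| |by []].
apply: (@leq_trans ((mu s1).+2 * (cost e1 + cost e2 + T).+1)%N).
  by rewrite mulSn; lia.
by rewrite leq_mul2r; lia.
Qed.

End Machine.

(** * Memory layout *)

Section Cells.
Local Open Scope ring_scope.

(* The memory is split into eight arrays: entry [k] of array [j] is cell
   [8 * k + j], and array 0 serves as the register file. *)
Definition cell (j : nat) (e : expr) : expr :=
  let d := Plus e e in let f := Plus d d in Plus (Plus f f) (Const (Posz j)).
Definition arr (j : nat) (e : expr) : expr := Fetch (cell j e).
Definition reg (k : nat) : expr := arr 0 (Const (Posz k)).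
Definition set_arr (j : nat) (e1 e2 : expr) : program := Store (cell j e1) e2.
Definition set_reg (k : nat) (e : expr) : program :=
  set_arr 0 (Const (Posz k)) e.

(** The sum repeats the doublings in [cell] literally, so that array accesses reduce to [get] and
    [put] by computation. *)
Definition get (s : memory) (j : nat) (z : int) : int :=
  s (absz (z + z + (z + z) + (z + z + (z + z)) + Posz j)).
Definition put (s : memory) (j : nat) (z x : int) : memory :=
  update s (absz (z + z + (z + z) + (z + z + (z + z)) + Posz j)) x.

(** By uniqueness of division by 8, distinct entries occupy distinct cells. *)
Lemma get_put s j j' k k' x : (j < 8)%N -> (j' < 8)%N ->
  get (put s j' (Posz k') x) j (Posz k) =
    if (j == j') && (k == k') then x else get s j (Posz k).
Proof.
move=> j8 j8'; rewrite /get /put /update; congr (if _ then _ else _).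
by apply/eqP/andP => [e|[/eqP-> /eqP->] //]; split; apply/eqP; lia.
Qed.

Lemma eval_arr inp s j e : eval inp s (arr j e) = get s j (eval inp s e).
Proof. by []. Qed.
Lemma eval_reg inp s k : eval inp s (reg k) = get s 0 (Posz k).
Proof. by []. Qed.
Lemma run_set_arr inp s j e1 e2 :
  run inp (set_arr j e1 e2) s = put s j (eval inp s e1) (eval inp s e2).
Proof. by []. Qed.
Lemma run_set_reg inp s k e :
  run inp (set_reg k e) s = put s 0 (Posz k) (eval inp s e).
Proof. by []. Qed.

Lemma run_seq inp s c1 c2 : run inp (Seq c1 c2) s = run inp c2 (run inp c1 s).
Proof. by []. Qed.
Lemma run_if inp s e1 e2 c1 c2 : run inp (IfLe e1 e2 c1 c2) s =
  if eval inp s e1 <= eval inp s e2 then run inp c1 s else run inp c2 s.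
Proof. by []. Qed.
Lemma run_skip inp s : run inp Skip s = s.
Proof. by []. Qed.
Lemma eval_const inp s z : eval inp s (Const z) = z.
Proof. by []. Qed.
Lemma eval_plus inp s e1 e2 :
  eval inp s (Plus e1 e2) = eval inp s e1 + eval inp s e2.
Proof. by []. Qed.
Lemma eval_minus inp s e1 e2 :
  eval inp s (Minus e1 e2) = eval inp s e1 - eval inp s e2.
Proof. by []. Qed.
Lemma eval_input inp s e : eval inp s (Input e) = inp`_(absz (eval inp s e)).
Proof. by []. Qed.

Definition evalE :=
  (eval_reg, eval_arr, eval_const, eval_plus, eval_minus, eval_input).

End Cells.

(** * The program *)

Definition rC := 0. Definition rO := 1. Definition rX := 2.
Definition rLast := 3. Definition rClock := 4. Definition rA := 5.
(** Registers from [rA] on are scratch. In a check [rP] and [rQ] hold the values of the item to its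
    owner and to agent [rX]; [rG], [rH], [rT] hold the triple of [decide]. A walk reuses [rP] and
    [rQ] for the parent and the item of an edge. *)
Definition rP := 6. Definition rQ := 7. Definition rG := 8.
Definition rH := 9. Definition rT := 10.
Definition aOwn := 1. Definition aLvl := 2. Definition aStamp := 3.
(** [aBase] tabulates where each row starts in the input, since the machine cannot multiply. *)
Definition aPar := 4. Definition aVia := 5. Definition aBase := 6.

Definition eN := Input (Const 0%R).
Definition eM := Input (Const 1%R).
Definition num (k : nat) := Const (Posz k).
Definition inc (k : nat) : program := set_reg k (Plus (reg k) (num 1)).
Fixpoint block (cs : seq program) : program :=
  if cs is c :: cs' then Seq c (block cs') else Skip.

(** A negative total in [rC] flips all signs. The pool has no row in the input, so its value -1 is
    set last, overriding what was read. *)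
Definition p_read := block [::
  set_reg rA (arr aOwn (reg rO));
  set_reg rP (Input (Plus (arr aBase (reg rA)) (reg rO)));
  set_reg rQ (Input (Plus (arr aBase (reg rX)) (reg rO)));
  IfLe (num 0) (reg rC) Skip
    (Seq (set_reg rP (Minus (num 0) (reg rP)))
         (set_reg rQ (Minus (num 0) (reg rQ))));
  IfLe eN (reg rA) (set_reg rP (Const (-1)%R)) Skip].

Definition p_choose (g h t : expr) := block [:: set_reg rG g; set_reg rH h;
  set_reg rT t].

(** The cases of [decide] are tried from the lowest priority to the highest, a later choice
    overwriting an earlier one. *)
Definition p_decide := block [::
  p_choose eN eN (num 2);
  IfLe (arr aStamp eN) (arr aStamp (reg rX))
    (IfLe (num 1) (reg rQ)
      (p_choose (reg rX) (reg rA) (Minus (arr aLvl (reg rA)) (reg rP)))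
      (IfLe (num 0) (reg rQ) (IfLe (num 1) (reg rP)
        (IfLe (num 1) (arr aLvl (reg rA)) (p_choose eN (reg rA) (num 0)) Skip)
        Skip) Skip))
    Skip;
  IfLe (arr aStamp eN) (arr aStamp (reg rA))
    (IfLe (reg rP) (Const (-1)%R)
      (p_choose (reg rA) (reg rX) (Plus (arr aLvl (reg rX)) (reg rQ))) Skip)
    Skip].

(* The owner of the item is [g] or [p]; subtracting it from [g + p] yields the
   other one. *)
Definition p_transfer := block [::
  set_reg rQ (arr aVia (reg rG));
  set_reg rP (arr aPar (reg rG));
  set_arr aOwn (reg rQ)
    (Minus (Plus (reg rG) (reg rP)) (arr aOwn (reg rQ)));
  set_reg rG (reg rP)].

Definition p_move := block [::
  set_arr aOwn (reg rO) (reg rX); set_arr aLvl (reg rH) (reg rT)].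
Definition p_walk := WhileLe (Plus (reg rG) (num 1)) eN p_transfer.
Definition p_reset := block [:: inc rClock; set_arr aStamp eN (reg rClock)].
Definition p_grow := block [:: inc rClock;
  set_arr aStamp (reg rH) (reg rClock);
  set_arr aPar (reg rH) (reg rG); set_arr aVia (reg rH) (reg rO)].

Definition p_act :=
  IfLe (reg rT) (num 1)
    (IfLe (num 0) (reg rT)
      (Seq p_move (Seq p_walk p_reset))
      (IfLe (Plus (arr aStamp (reg rH)) (num 1)) (arr aStamp eN) p_grow Skip))
    Skip.

Definition p_check := block [:: p_read; p_decide; p_act; inc rX].
Definition p_row := block [:: set_reg rX (num 0);
  WhileLe (Plus (reg rX) (num 1)) eN p_check; inc rO].
Definition p_scan := block [:: set_reg rLast (reg rClock); set_reg rO (num 0);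
  WhileLe (Plus (reg rO) (num 1)) eM p_row].
(** [rLast] is the clock at the start of the latest scan; the search stops after a scan without a
    tick. *)
Definition p_search := WhileLe (Plus (reg rLast) (num 1)) (reg rClock) p_scan.

Definition p_base := block [::
  set_arr aBase (Plus (reg rX) (num 1)) (Plus (arr aBase (reg rX)) eM); inc rX].
Definition p_pool := block [::
  set_arr aOwn (reg rO) eN;
  set_reg rC (Plus (reg rC) (Input (Plus (num 2) (reg rO)))); inc rO].
Definition p_init := block [:: set_arr aBase (num 0) (num 2);
  WhileLe (Plus (reg rX) (num 1)) eN p_base;
  WhileLe (Plus (reg rO) (num 1)) eM p_pool;
  set_reg rClock (num 1); set_arr aStamp eN (num 1)].

Definition p_give := block [::
  IfLe eN (arr aOwn (reg rO))
    (block [:: set_arr aOwn (reg rO) (reg rX); inc rX;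
       IfLe eN (reg rX) (set_reg rX (num 0)) Skip])
    Skip;
  inc rO].
Definition p_fill := block [:: set_reg rX (num 0); set_reg rO (num 0);
  WhileLe (Plus (reg rO) (num 1)) eM p_give].

Definition p_print_item := block [::
  IfLe (arr aOwn (reg rO)) (reg rX)
    (IfLe (reg rX) (arr aOwn (reg rO)) (Write (num 1)) (Write (num 0)))
    (Write (num 0));
  inc rO].
Definition p_print_row := block [:: set_reg rO (num 0);
  WhileLe (Plus (reg rO) (num 1)) eM p_print_item; inc rX].
Definition p_print := block [:: set_reg rX (num 0);
  WhileLe (Plus (reg rX) (num 1)) eN p_print_row].

(* With no items the input shows the number of agents in binary only, so that
   a loop over the agents would not run in polynomial time. *)
Definition p_main := IfLe (num 1) eM
  (block [:: p_init; p_search; p_fill; p_print]) Skip.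

(** * Correctness of the program *)

Section Program.
Local Open Scope ring_scope.

Variables (n m : nat) (inp : seq int).
Hypotheses (inp0 : inp`_0 = n) (inp1 : inp`_1 = m).

(* [c0] is the partial sum of the first row of the input, and [nb] counts the
   rows whose position in the input is known so far. *)
Record stores_with (nb : nat) (c0 : int) (s : memory) (st : state)
    (o x l : nat) : Prop := Stores {
  stores_own : forall k : nat, get s aOwn k = own st k;
  stores_lvl : forall k : nat, get s aLvl k = lvl st k;
  stores_stamp : forall k : nat, get s aStamp k = stamp st k;
  stores_par : forall k : nat, get s aPar k = par st k;
  stores_via : forall k : nat, get s aVia k = via st k;
  stores_base : forall k : nat, (k <= nb)%N -> get s aBase k = (2 + k * m)%N;
  stores_clock : get s 0 rClock = clock st;
  stores_C : get s 0 rC = c0;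
  stores_O : get s 0 rO = o;
  stores_X : get s 0 rX = x;
  stores_Last : get s 0 rLast = l }.

#[local] Arguments run : simpl never.
#[local] Arguments block : simpl never.
#[local] Arguments get : simpl never.
#[local] Arguments put : simpl never.

Lemma run_block s ct cs :
  run inp (block (ct :: cs)) s = run inp (block cs) (run inp ct s).
Proof. by []. Qed.

Lemma run_nil s : run inp (block [::]) s = s.
Proof. by []. Qed.

Lemma stores_scratch nb c0 s st o x l k v : (4 < k)%N ->
  stores_with nb c0 s st o x l ->
    stores_with nb c0 (put s 0 (Posz k) v) st o x l.
Proof.
move=> k4 [? ? ? ? ? sb ? ? ? ? ?]; split=> [i|i|i|i|i|i kn|||||];
  by rewrite get_put //= ?sb //; case: eqP => // e; move: k4; rewrite -e.
Qed.

Lemma stores_set_own nb c0 s st o x l (k v : nat) :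
  stores_with nb c0 s st o x l ->
  stores_with nb c0 (put s aOwn k v)
    (State (upd (own st) k v) (lvl st) (stamp st) (par st) (via st) (clock st))
      o x l.
Proof.
by case=> ? ? ? ? ? sb ? ? ? ? ?; split=> *; rewrite get_put ?sb //= /upd;
  case: eqP.
Qed.

Lemma stores_set_lvl nb c0 s st o x l (k : nat) v :
  stores_with nb c0 s st o x l ->
  stores_with nb c0 (put s aLvl k v)
    (State (own st) (upd (lvl st) k v) (stamp st) (par st) (via st) (clock st))
      o x l.
Proof.
by case=> ? ? ? ? ? sb ? ? ? ? ?; split=> *; rewrite get_put ?sb //= /upd;
  case: eqP.
Qed.

Lemma stores_set_stamp nb c0 s st o x l (k v : nat) :
  stores_with nb c0 s st o x l ->
  stores_with nb c0 (put s aStamp k v)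
    (State (own st) (lvl st) (upd (stamp st) k v) (par st) (via st) (clock st))
      o x l.
Proof.
by case=> ? ? ? ? ? sb ? ? ? ? ?; split=> *; rewrite get_put ?sb //= /upd;
  case: eqP.
Qed.

Lemma stores_set_par nb c0 s st o x l (k v : nat) :
  stores_with nb c0 s st o x l ->
  stores_with nb c0 (put s aPar k v)
    (State (own st) (lvl st) (stamp st) (upd (par st) k v) (via st) (clock st))
      o x l.
Proof.
by case=> ? ? ? ? ? sb ? ? ? ? ?; split=> *; rewrite get_put ?sb //= /upd;
  case: eqP.
Qed.

Lemma stores_set_via nb c0 s st o x l (k v : nat) :
  stores_with nb c0 s st o x l ->
  stores_with nb c0 (put s aVia k v)
    (State (own st) (lvl st) (stamp st) (par st) (upd (via st) k v) (clock st))
      o x l.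
Proof.
by case=> ? ? ? ? ? sb ? ? ? ? ?; split=> *; rewrite get_put ?sb //= /upd;
  case: eqP.
Qed.

Lemma stores_set_clock nb c0 s st o x l (v : nat) :
  stores_with nb c0 s st o x l ->
  stores_with nb c0 (put s 0 rClock v)
    (State (own st) (lvl st) (stamp st) (par st) (via st) v) o x l.
Proof.
by case=> ? ? ? ? ? sb ? ? ? ? ?; split=> *; rewrite get_put //= ?sb.
Qed.

Lemma stores_set_C nb c0 s st o x l v : stores_with nb c0 s st o x l ->
  stores_with nb v (put s 0 rC v) st o x l.
Proof.
by case=> ? ? ? ? ? sb ? ? ? ? ?; split=> *; rewrite get_put //= ?sb.
Qed.

Lemma stores_set_base nb c0 s st o x l : stores_with nb c0 s st o x l ->
  stores_with nb.+1 c0 (put s aBase nb.+1 (2 + nb.+1 * m)%N) st o x l.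
Proof.
case=> ? ? ? ? ? sb ? ? ? ? ?; split=> *; rewrite get_put //=.
by rewrite /=; case: eqP => [->//|ne]; apply: sb; lia.
Qed.

Lemma stores_set_O nb c0 s st o x l (v : nat) : stores_with nb c0 s st o x l ->
  stores_with nb c0 (put s 0 rO v) st v x l.
Proof.
by case=> ? ? ? ? ? sb ? ? ? ? ?; split=> *; rewrite get_put //= ?sb.
Qed.

Lemma stores_set_X nb c0 s st o x l (v : nat) : stores_with nb c0 s st o x l ->
  stores_with nb c0 (put s 0 rX v) st o v l.
Proof.
by case=> ? ? ? ? ? sb ? ? ? ? ?; split=> *; rewrite get_put //= ?sb.
Qed.

Lemma stores_set_Last nb c0 s st o x l (v : nat) :
  stores_with nb c0 s st o x l ->
  stores_with nb c0 (put s 0 rLast v) st o x v.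
Proof.
by case=> ? ? ? ? ? sb ? ? ? ? ?; split=> *; rewrite get_put //= ?sb.
Qed.

(** Here and below the numerical constants are generous roundings; only the polynomial shape of the
    bounds matters. *)
Definition T_init := (n.+1 * 1000 + m.+1 * 1000 + 2000)%N.

(** The pool has stamp 1 and all others 0, so that no agent is reached. *)
Definition start (ow : nat -> nat) : state :=
  State ow (fun=> 0) (upd (fun=> 0%N) n 1%N) (fun=> 0%N) (fun=> 0%N) 1%N.

Lemma runs_init : runs inp p_init (fun=> 0) T_init [::] (fun s' => exists ow,
  stores_with n (\sum_(o < m) inp`_(2 + o)) s' (start ow) m n 0 /\
  forall o, (o < m)%N -> ow o = n).
Proof.
pose blank ow := State ow (fun=> 0) (fun=> 0%N) (fun=> 0%N) (fun=> 0%N) 0%N.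
pose J1 k s := stores_with k 0 s (blank (fun=> 0%N)) 0 k 0.
pose J2 k s := exists ow, stores_with n (\sum_(0 <= i < k) inp`_(2 + i)) s
  (blank ow) k n 0 /\ forall o, (o < k)%N -> ow o = n.
apply: (@runs_seq_silent _ _ _ _ 500 (n.+1 * 1000 + m.+1 * 1000 + 1000)
  _ (J1 0%N)) => [||s1 S1].
- by rewrite /T_init; lia.
- apply: runs_loop_free_le => //; rewrite run_set_arr !evalE.
  by split=> // -[|k] //; rewrite get_put.
apply: (@runs_seq_silent _ _ _ _ (n.+1 * 1000) (m.+1 * 1000 + 1000) _ (J1 n)) =>
  [||s2 S2].
- by lia.
(* A silent loop is a counted loop with an empty output at each round. *)
- have -> : [::] = flatten [seq ([::] : seq int) | _ <- iota 0 n].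
    by elim: (iota _ _).
  apply: runs_weaken (runs_for (N := n) (T := 900) (J := J1) _ _ S1) _ _ => //.
  + move=> k s2 kn S2; rewrite !evalE (stores_X S2) inp0; split; first by lia.
    apply: runs_loop_free_le => //;
      rewrite /p_base run_block run_set_arr !evalE.
    rewrite (stores_X S2) (stores_base S2) // inp1.
    have -> : (2 + k * m)%N%:Z + m%:Z = (2 + k.+1 * m)%N by lia.
    rewrite -PoszD addn1; have S3 := stores_set_base S2.
    rewrite run_block run_set_reg !evalE (stores_X S3) run_nil -PoszD addn1.
    exact: stores_set_X S3.
  + by move=> s2 S2; rewrite !evalE (stores_X S2) inp0; lia.
  + by rewrite leq_mul2l orbC.
apply: (@runs_seq_silent _ _ _ _ (m.+1 * 1000) 1000 _ (J2 m)) =>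
  [|| s3 [ow [S3 ow_n]]].
- by lia.
- have -> : [::] = flatten [seq ([::] : seq int) | _ <- iota 0 m].
    by elim: (iota _ _).
  have J20 : J2 0%N s2 by exists (fun=> 0%N); rewrite big_geq.
  apply: runs_weaken (runs_for (N := m) (T := 900) (J := J2) _ _ J20) _ _ => //.
  + move=> k s3 km [ow [S3 ow_n]]; rewrite !evalE (stores_O S3) inp1; split;
    first by lia.
    apply: runs_loop_free_le => //;
      rewrite /p_pool run_block run_set_arr !evalE.
    rewrite (stores_O S3) inp0; have S4 := stores_set_own k n S3.
    rewrite run_block run_set_reg !evalE (stores_O S4) (stores_C S4) /=.
    set z := (_ + inp`_(2 + k)); have S5 := stores_set_C z S4.
    rewrite run_block run_set_reg !evalE (stores_O S5) run_nil -PoszD addn1.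
    exists (upd ow k n); rewrite big_nat_recr //=; split;
      first exact: stores_set_O S5.
    move=> o; rewrite ltnS leq_eqVlt /upd; case: eqP => //= _; exact: ow_n.
  + by move=> s3 [ow [S3 _]]; rewrite !evalE (stores_O S3) inp1; lia.
  + by rewrite leq_mul2l orbC.
apply: runs_loop_free_le => //; rewrite run_seq run_set_reg !evalE.
rewrite run_seq run_set_arr !evalE inp0 run_skip.
exists ow; split=> //; rewrite -(big_mkord xpredT (fun o => inp`_(2 + o))).
apply: (stores_set_stamp _ _ (st := State _ _ _ _ _ _)).
exact: stores_set_clock S3.
Qed.

(** * The search for exchanges *)

Variable c : int.
(** The input matrix with a row for the pool added and, if [c] is negative, with all signs
    flipped. *)
Let V (i o : nat) : int :=
  if i == n then -1
  else if 0 <= c then inp`_(2 + i * m + o) else - inp`_(2 + i * m + o).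
Hypothesis V_bound : forall i o, (i < n)%N -> (o < m)%N -> -1 <= V i o <= 1.
Let V_pool : forall o, (o < m)%N -> V n o = -1.
Proof. by rewrite /V eqxx. Qed.

Local Notation stores := (stores_with n c).

Lemma run_read s st o x l : stores s st o x l ->
  (own st o <= n)%N -> (x < n)%N ->
  let s' := run inp p_read s in
  [/\ stores s' st o x l, get s' 0 rA = own st o,
      get s' 0 rP = V (own st o) o & get s' 0 rQ = V x o].
Proof.
move=> S on xn; have [sown slvl sst spar svia sbase sclk sC sO sX sL] := S.
rewrite /p_read run_block run_set_reg !evalE sO sown.
rewrite run_block run_set_reg !evalE !get_put //= sO sbase //.
rewrite run_block run_set_reg !evalE !get_put //= sO sX !get_put //= sbase;
  last exact: ltnW.
rewrite run_block run_if !evalE !get_put //= sC.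
set s1 := if _ then _ else _.
have [S1 A1 P1 Q1] : [/\ stores s1 st o x l, get s1 0 rA = own st o,
    get s1 0 rP = (if 0 <= c then inp`_(2 + own st o * m + o)
                   else - inp`_(2 + own st o * m + o)) & get s1 0 rQ = V x o].
  rewrite /V (ltn_eqF xn) /s1 /=; case: leP => c0.
    by rewrite run_skip; split; rewrite ?get_put //; do !apply: stores_scratch.
  rewrite run_seq !run_set_reg !evalE !get_put //= !sub0r; split;
    rewrite ?get_put //.
  by do !apply: stores_scratch.
rewrite run_block run_if !evalE A1 /= inp0.
rewrite {1}/V lez_nat; case: leqP => na; rewrite ?run_set_reg ?run_skip.
  have -> : own st o == n by rewrite eqn_leq on na.
  by split; rewrite ?get_put //; apply: stores_scratch.
by rewrite ltn_eqF.
Qed.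

Lemma run_choose s g h t (s1 := put s 0 rG (eval inp s g))
    (s2 := put s1 0 rH (eval inp s1 h)) :
  run inp (p_choose g h t) s = put s2 0 rT (eval inp s2 t).
Proof. by []. Qed.

Lemma run_decide s st o x l g h t : stores s st o x l ->
  get s 0 rA = own st o -> get s 0 rP = V (own st o) o -> get s 0 rQ = V x o ->
  decide n V st o x = (g, h, t) ->
  let s' := run inp p_decide s in
  [/\ stores s' st o x l, get s' 0 rG = g, get s' 0 rH = h & get s' 0 rT = t].
Proof.
rewrite /decide; set a := own st o; move=> S0 A0 P0 Q0.
rewrite /p_decide run_block run_choose !evalE inp0.
set s1 := put _ 0 rT _.
have [S1 [A1 P1 Q1] [G1 H1 T1]] : [/\ stores s1 st o x l,
    [/\ get s1 0 rA = a, get s1 0 rP = V a o & get s1 0 rQ = V x o] &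
    [/\ get s1 0 rG = n, get s1 0 rH = n & get s1 0 rT = 2%:Z]].
  split; [by do !apply: stores_scratch| |]; split; by rewrite !get_put.
clearbody s1.
have [sown slvl sst _ _ _ _ _ _ sX _] := S1.
rewrite run_block run_if !evalE inp0 sX !sst lez_nat.
rewrite run_if !evalE Q1 run_choose run_if !evalE Q1 run_if !evalE P1 run_if
  !evalE.
rewrite A1 slvl run_choose !evalE run_skip inp0 sX !get_put //= A1 P1 !get_put
  //= slvl.
set s2 := if _ then _ else s1;
  set d := if (stamp st n <= stamp st x)%N then _ else _ => dec.
have [S2 [A2 P2 Q2] [G2 H2 T2]] : [/\ stores s2 st o x l,
    [/\ get s2 0 rA = a, get s2 0 rP = V a o & get s2 0 rQ = V x o] &
    [/\ get s2 0 rG = d.1.1, get s2 0 rH = d.1.2 & get s2 0 rT = d.2]].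
  rewrite /s2 /d; do ?[case: ifP => ? /=]; try by split.
    by split; [by do !apply: stores_scratch| |]; split; rewrite ?get_put.
  by split; [by do !apply: stores_scratch| |]; split; rewrite ?get_put.
clearbody s2; clear s1 S1 A1 P1 Q1 G1 H1 T1 sown slvl sst sX s S0 A0 P0 Q0.
have [sown slvl sst _ _ _ _ _ _ sX _] := S2.
rewrite run_block !run_if !evalE inp0 A2 P2 run_choose !evalE !sst lez_nat
  run_skip.
rewrite A2 !get_put //= sX !get_put //= slvl Q2.
move: dec G2 H2 T2; rewrite run_nil.
case: (_ <= stamp st a)%N => /=; last by rewrite -/d => ->.
case: ifP => _; last by rewrite -/d => ->.
case=> <- <- <- _ _ _; split; rewrite ?get_put //; by do !apply: stores_scratch.
Qed.

Definition T_walk := ((budget n m).+1 * 1000)%N.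

(** The variant is the stamp of the agent in [rG], which drops along every edge. *)
Lemma runs_walk s st lv ow target o x l (g : nat) :
  stores s (State ow lv (stamp st) (par st) (via st) (clock st)) o x l ->
  get s 0 rG = g -> walking n m V st target ow g ->
  (stamp st g <= budget n m)%N ->
  runs inp p_walk s T_walk [::] (fun s' => exists ow',
    stores s' (State ow' lv (stamp st) (par st) (via st) (clock st)) o x l /\
    walking n m V st target ow' n).
Proof.
move=> S G W sg.
pose J (s : memory) := exists ow (g : nat),
  [/\ stores s (State ow lv (stamp st) (par st) (via st) (clock st)) o x l,
      get s 0 rG = g & walking n m V st target ow g].
pose mu (s : memory) := absz (get s aStamp (get s 0 rG)).
have muE s' ow' (g' : nat) :
    stores s' (State ow' lv (stamp st) (par st) (via st) (clock st)) o x l ->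
    get s' 0 rG = g' -> mu s' = stamp st g'.
  by move=> S' G'; rewrite /mu G' (stores_stamp S').
have Js : J s by exists ow, g.
apply: (@runs_weaken _ _ _ ((mu s).+1 *
    (cost (Plus (reg rG) (num 1)) + cost eN + steps p_transfer).+1)
    _ _ (fun s' => J s' /\ eval inp s' eN < eval inp s'
      (Plus (reg rG) (num 1)))).
- apply: runs_while => //.
  move=> s1 [ow1 [g1 [S1 G1 W1]]]; rewrite !evalE G1 inp0 => le1.
  have g1n : (g1 < n)%N by lia.
  have [own1 pg W2] := walk_step W1 g1n.
  apply: runs_loop_free => //.
  rewrite /p_transfer run_block run_set_reg !evalE G1 (stores_via S1).
  rewrite run_block run_set_reg !evalE !get_put //= G1 !get_put //=
    (stores_par S1).
  rewrite run_block run_set_arr !evalE !get_put //= G1 (stores_own S1) /=.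
  rewrite run_block run_set_reg !evalE !get_put //= run_nil.
  (* Truncated subtraction agrees with that of integers because the owner is one of the two
     summands. *)
  have -> : g1%:Z + (par st g1)%:Z - (ow1 (via st g1))%:Z =
      (g1 + par st g1 - ow1 (via st g1))%N.
    by case: own1 => ->; lia.
  set s2 := put _ 0 rG _.
  have S2 : stores s2 (State
      (upd ow1 (via st g1) (g1 + par st g1 - ow1 (via st g1))%N) lv
      (stamp st) (par st) (via st) (clock st)) o x l.
    apply: stores_scratch => //;
      apply: (stores_set_own _ _ (st := State _ _ _ _ _ _)).
    by do !apply: stores_scratch.
  have G2 : get s2 0 rG = par st g1 by rewrite get_put.
  split; last by rewrite (muE _ _ _ S2 G2) (muE _ _ _ S1 G1).
  by eexists; exists (par st g1); split; [exact: S2| |].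
- by rewrite (muE _ _ _ S G); apply: leq_mul.
move=> s' [[ow' [g' [S' G' W']]]]; rewrite !evalE G' inp0 => ng.
have gn := walk_le W'; have e : g' = n by lia.
by exists ow'; split=> //; rewrite e in W'.
Qed.

Lemma stores_inc_clock s st o x l : stores s st o x l ->
  stores (run inp (inc rClock) s)
   (State (own st) (lvl st) (stamp st) (par st) (via st) (clock st).+1) o x l.
Proof.
move=> S; rewrite /inc run_set_reg !evalE (stores_clock S) -PoszD addn1.
exact: stores_set_clock.
Qed.

Definition T_act := (T_walk + 3000)%N.

(** If [t] is 0 or 1, [decide_win] starts a walk, whose length is bounded because stamps stay below
    the clock and the clock below the budget. If [t] is negative and [h] unreached, [decide_grow]
    applies; otherwise the pair is quiet. *)
Lemma runs_act s st o x l g h t : inv n m V st -> stores s st o x l ->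
  (o < m)%N -> (x < n)%N -> decide n V st o x = (g, h, t) ->
  get s 0 rG = g -> get s 0 rH = h -> get s 0 rT = t ->
  runs inp p_act s T_act [::] (fun s' => exists st', [/\ stores s' st' o x l,
    inv n m V st' & (st' = st /\ quiet n V st o x) \/
      (clock st < clock st')%N]).
Proof.
move=> I S om xn dec G H T.
have Sst := stores_stamp S; have [_ _ _ _ _ _ _ _ SO SX _] := S.
apply: (@runs_if_le _ _ _ _ _ _ (T_walk + 2900)%N) => [|t1|];
  first by rewrite /T_act /=; lia.
- apply: (@runs_if_le _ _ _ _ _ _ (T_walk + 2800)%N) => [||]; rewrite ?evalE ?T;
    first by rewrite /=; lia.
  + rewrite !evalE T in t1; move=> t0; have t01 : 0 <= t <= 1 by rewrite t0.
    have [hn [r [W rE]]] := decide_win V_bound V_pool I om xn dec t01.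
    have gn := walk_le W.
    apply: (@runs_seq_silent _ _ _ _ (steps p_move) (T_walk + steps p_reset)).
    * by rewrite addnCA leq_add2l.
    * apply: (runs_loop_free (Q := fun s' => stores s'
        (State (upd (own st) o x) (upd (lvl st) h t) (stamp st) (par st)
          (via st) (clock st)) o x l /\ get s' 0 rG = g)) => //.
      rewrite /p_move run_block run_set_arr !evalE SO SX run_block run_set_arr
        !evalE.
      rewrite !get_put //= H T run_nil; split; last by rewrite !get_put.
      apply: (stores_set_lvl _ _ (st := State _ _ _ _ _ _)).
      exact: stores_set_own.
    move=> s1 [S1 G1]; apply: (@runs_seq_silent _ _ _ _ T_walk (steps p_reset))
      => //.
      apply: runs_walk S1 G1 W _.
      apply: leq_trans (inv_clock I gn) _.
      by apply: leq_trans (inv_potential I); exact: leq_addr.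
    move=> s2 [ow [S2 W2]]; apply: runs_loop_free => //.
    rewrite /p_reset run_block run_block run_nil run_set_arr !evalE inp0.
    have S3 := stores_inc_clock S2; rewrite (stores_clock S3).
    eexists; split; [exact: (stores_set_stamp _ _ S3)| |by right => /=].
    by have := walk_end V_pool I hn t01 rE W2.
  + move=> tlt0; apply: runs_loop_free_le => //.
    rewrite run_if !evalE H inp0 !Sst run_skip -PoszD addn1 lez_nat.
    case: leqP => hS.
      exists st; split=> //; left; split=> //.
      by rewrite /quiet dec tlt0 hS orbT.
    have S1 := stores_inc_clock S; rewrite /p_grow run_block.
    have G1 : get (run inp (inc rClock) s) 0 rG = g
      by rewrite run_set_reg get_put.
    have H1 : get (run inp (inc rClock) s) 0 rH = h
      by rewrite run_set_reg get_put.
    move: (run inp _ s) S1 G1 H1 => s1 S1 G1 H1.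
    rewrite run_block run_set_arr !evalE H1 (stores_clock S1).
    rewrite run_block run_set_arr !evalE !get_put //= G1 H1.
    rewrite run_block run_set_arr !evalE !get_put //= H1 (stores_O S1) run_nil.
    eexists; split; [|exact: (decide_grow V_bound V_pool I om xn dec tlt0 hS)|
      by right => /=].
    apply: (stores_set_via _ _ (st := State _ _ _ _ _ _)).
    apply: (stores_set_par _ _ (st := State _ _ _ _ _ _)).
    exact: (stores_set_stamp _ _ S1).
- rewrite !evalE T => tgt1; apply: runs_loop_free_le => //; rewrite run_skip.
  by exists st; split=> //; left; split=> //; rewrite /quiet dec tgt1.
Qed.

Definition T_check := (T_act + 3000)%N.

Lemma runs_check s st o x l : inv n m V st -> stores s st o x l ->
  (o < m)%N -> (x < n)%N ->
  runs inp p_check s T_check [::] (fun s' =>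
    exists st', [/\ stores s' st' o x.+1 l,
    inv n m V st' & (st' = st /\ quiet n V st o x) \/
      (clock st < clock st')%N]).
Proof.
move=> I S om xn; have [S1 A1 P1 Q1] := run_read S (inv_own I om) xn.
case dec: (decide n V st o x) => [[g h] t].
have [S2 G2 H2 T2] := run_decide S1 A1 P1 Q1 dec.
apply: (@runs_seq_silent _ _ _ _ (steps p_read) (T_act + 2000)) => [||s1 E1].
- by rewrite /T_check; have : (steps p_read <= 1000)%N by []; lia.
- by apply: (runs_loop_free (Q := fun s' => s' = run inp p_read s)).
apply: (@runs_seq_silent _ _ _ _ (steps p_decide) (T_act + 200)) => [||s2 E2].
- have : (steps p_decide <= 1800)%N by []; lia.
- by apply: (runs_loop_free (Q := fun s' => s' = run inp p_decide s1)).
rewrite -{}E1 -{}E2 in S2 G2 H2 T2.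
apply: (@runs_seq_silent _ _ _ _ T_act 200) => //.
  exact: runs_act I S2 om xn dec G2 H2 T2.
move=> s3 [st' [S3 I3 alt]]; apply: runs_loop_free_le => //.
exists st'; split=> //.
rewrite run_seq run_skip run_set_reg !evalE (stores_X S3) -PoszD addn1.
exact: stores_set_X S3.
Qed.

(** A tick may invalidate quietness observed earlier, so quietness is claimed only if the state has
    not changed at all. *)
Definition progress (st st' : state) (P : nat -> nat -> Prop) : Prop :=
  (st' = st /\ forall o x, P o x -> (x < n)%N -> quiet n V st o x) \/
  (clock st < clock st')%N.

Definition T_row := (n.+1 * (100 + T_check) + 1000)%N.

Lemma runs_row s st o x l : inv n m V st -> stores s st o x l -> (o < m)%N ->
  runs inp p_row s T_row [::] (fun s' =>
    exists st' x', [/\ stores s' st' o.+1 x' l,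
    inv n m V st' & progress st st' (fun o' _ => o' = o)]).
Proof.
move=> I S om.
pose J k s' := exists st', [/\ stores s' st' o k l, inv n m V st' &
  progress st st' (fun o' x' => o' = o /\ (x' < k)%N)].
apply: (@runs_seq_silent _ _ _ _ 500 (n.+1 * (100 + T_check) + 500) _ (J 0%N))
  => [||s1 S1].
- by rewrite /T_row; lia.
- apply: runs_loop_free_le => //; rewrite run_set_reg !evalE.
  exists st; split=> //; first exact: stores_set_X S.
  by left; split=> // ? ? [].
apply: (@runs_seq_silent _ _ _ _ (n.+1 * (100 + T_check)) 500 _ (J n)) =>
  [|| s2 [st2 [S2 I2 P2]]].
- by lia.
- have -> : [::] = flatten [seq ([::] : seq int) | _ <- iota 0 n].
    by elim: (iota _ _).
  apply: runs_weaken (runs_for (N := n) (T := T_check) (J := J)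
    _ _ S1) _ _ => //.
  + move=> k s2 kn [st2 [S2 I2 P2]]; rewrite !evalE (stores_X S2) inp0.
    split; first by lia.
    apply: runs_weaken (runs_check I2 S2 om kn) _ _ => //.
    move=> s3 [st3 [S3 I3 P3]]; exists st3; split=> //.
    case: P3 P2 => [[-> q3]|lt3] [[e q2]|lt2]; [left|by right|right|right].
    * split=> // o' x' [-> ]; rewrite ltnS leq_eqVlt => /orP[/eqP->|x'k] x'n.
        by rewrite -e.
      exact: q2.
    * by rewrite -e.
    * exact: ltn_trans lt2 lt3.
  + by move=> s2 [st2 [S2 _ _]]; rewrite !evalE (stores_X S2) inp0; lia.
  + rewrite leq_mul2l; apply/orP; right; rewrite -addSn leq_add2r //.
apply: runs_loop_free_le => //.
rewrite run_seq run_skip run_set_reg !evalE (stores_O S2) -PoszD addn1.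
exists st2, n; split=> //; first exact: stores_set_O S2.
case: P2 => [[-> q]|lt]; [left|by right].
by split=> // o' x' -> x'n; apply: q.
Qed.

Definition T_scan := (m.+1 * (100 + T_row) + 1000)%N.

Lemma runs_scan s st o x l : inv n m V st -> stores s st o x l ->
  runs inp p_scan s T_scan [::] (fun s' => exists st' o' x',
    [/\ stores s' st' o' x' (clock st), inv n m V st' &
      progress st st' (fun o' _ => (o' < m)%N)]).
Proof.
move=> I S.
pose J k s' := exists st' x', [/\ stores s' st' k x' (clock st), inv n m V st' &
  progress st st' (fun o' _ => (o' < k)%N)].
apply: (@runs_seq_silent _ _ _ _ 500 (m.+1 * (100 + T_row) + 500) _
  (fun s1 => stores s1 st o x (clock st))) => [||s1 S1].
- by rewrite /T_scan; lia.
- apply: runs_loop_free_le => //; rewrite run_set_reg !evalE (stores_clock S).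
  exact: stores_set_Last S.
apply: (@runs_seq_silent _ _ _ _ 100 (m.+1 * (100 + T_row) + 100) _ (J 0%N)) =>
  [||s2 J2].
- by lia.
- apply: runs_loop_free_le => //; rewrite run_set_reg !evalE.
  exists st, x; split=> //; first exact: stores_set_O S1.
  by left.
apply: (@runs_seq_silent _ _ _ _ (m.+1 * (100 + T_row)) 100 _ (J m)) =>
  [|| s3 [st3 [x3 J3]]].
- by lia.
- have -> : [::] = flatten [seq ([::] : seq int) | _ <- iota 0 m].
    by elim: (iota _ _).
  apply: runs_weaken (runs_for (N := m) (T := T_row) (J := J) _ _ J2) _ _ => //.
  + move=> k s3 km [st3 [x3 [S3 I3 P3]]]; rewrite !evalE (stores_O S3) inp1.
    split; first by lia.
    apply: runs_weaken (runs_row I3 S3 km) _ _ => //.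
    move=> s4 [st4 [x4 [S4 I4 P4]]]; exists st4, x4; split=> //.
    case: P4 P3 => [[-> q4]|lt4] [[e q3]|lt3]; [left|by right|right|right].
    * split=> // o' x'; rewrite ltnS leq_eqVlt => /orP[/eqP->|o'k] x'n.
        by rewrite -e; exact: q4.
      exact: q3.
    * by rewrite -e.
    * exact: ltn_trans lt3 lt4.
  + by move=> s3 [st3 [x3 [S3 _ _]]]; rewrite !evalE (stores_O S3) inp1; lia.
  + by rewrite leq_mul2l; apply/orP; right; rewrite -addSn leq_add2r.
by apply: runs_loop_free_le => //; exists st3, m, x3.
Qed.

Definition T_search := ((budget n m).+1 * (100 + T_scan))%N.

(** Every further scan records a larger clock in [rLast], and the clock never exceeds the budget. *)
Lemma runs_search s st o x l : inv n m V st -> stores s st o x l ->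
  (l < clock st)%N ->
  runs inp p_search s T_search [::] (fun s' => exists st' o' x' l',
    [/\ stores s' st' o' x' l', inv n m V st' &
      forall o x, (o < m)%N -> (x < n)%N -> quiet n V st' o x]).
Proof.
move=> I S lc.
pose J s' := exists st' o' x' l', [/\ stores s' st' o' x' l', inv n m V st',
  (l' <= clock st')%N & l' = clock st' ->
  forall o x, (o < m)%N -> (x < n)%N -> quiet n V st' o x].
pose mu (s' : memory) := (budget n m - absz (get s' 0 rLast))%N.
(* No scan has taken place yet: the claim of quietness is vacuous since [l] lies below the clock. *)
have Js : J s.
  by exists st, o, x, l; split=> //; [exact: ltnW|move=> e;
    rewrite e ltnn in lc].
apply: runs_weaken (runs_while (T := T_scan) (mu := mu) (J := J) _ Js) _ _.
- move=> s1 [st1 [o1 [x1 [l1 [S1 I1 le1 _]]]]].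
  rewrite !evalE (stores_Last S1) (stores_clock S1) => guard.
  apply: runs_weaken (runs_scan I1 S1) _ _ => // s2 [st2 [o2 [x2 [S2 I2 P2]]]].
  split.
    exists st2, o2, x2, (clock st1); split=> //.
      by case: P2 => [[->]//|/ltnW].
    by case: P2 => [[-> q] _|lt e]; [move=> *; exact: q|rewrite e ltnn in lt].
  rewrite /mu (stores_Last S1) (stores_Last S2) /=.
  by have := inv_potential I1; lia.
- by apply: leq_mul; [rewrite ltnS; exact: leq_subr|rewrite -addSn leq_add2r].
move=> s' [[st' [o' [x' [l' [S' I' le' q]]]]]].
rewrite !evalE (stores_Last S') (stores_clock S') => guard.
by exists st', o', x', l'; split=> //; apply: q; lia.
Qed.

Lemma inv_start ow : (forall o, (o < m)%N -> ow o = n) ->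
  inv n m V (start ow).
Proof.
move=> ow_n; split=> //= [o om|i i_n|z zn|i i_n|].
- by rewrite ow_n.
- by rewrite /worth big_pred0 // => o; rewrite ow_n ?gtn_eqF.
- by rewrite /upd eqxx ltn_eqF.
- by rewrite /upd; case: eqP.
have := unreached_le n (upd (fun=> 0%N) n 1%N).
have := pool_le n m ow; rewrite /potential /budget /= /ones big1 // mul0n addn0.
move: (pool _ _ _) (unreached _ _) => a b am bn.
have : (a * (n + 2) ^ 2 <= m * (n + 2) ^ 2)%N by rewrite leq_mul2r am orbT.
lia.
Qed.

(** * Round robin and output *)

Definition T_fill := (m.+1 * 3000 + 1000)%N.

Lemma runs_fill s st o x l : (0 < n)%N -> stores s st o x l ->
  filling n m V (own st) 0 0 ->
  runs inp p_fill s T_fill [::] (fun s' => exists st' o' x' x,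
    stores s' st' o' x' l /\ filling n m V (own st') m x).
Proof.
move=> n_gt0 S F.
pose J k s := exists st x,
  [/\ stores s st k x l, filling n m V (own st) k x & (x < n)%N].
apply: (@runs_seq_silent _ _ _ _ 100 (m.+1 * 3000 + 900) _
  (fun s1 => stores s1 st o 0 l)) => [||s1 S1].
- by rewrite /T_fill; lia.
- apply: runs_loop_free_le => //; rewrite run_set_reg !evalE.
  exact: stores_set_X S.
apply: (@runs_seq_silent _ _ _ _ 100 (m.+1 * 3000 + 100) _ (J 0%N)) =>
  [||s2 J2].
- by lia.
- apply: runs_loop_free_le => //; rewrite run_set_reg !evalE.
  by exists st, 0%N; split=> //; exact: stores_set_O S1.
apply: (@runs_seq_silent _ _ _ _ (m.+1 * 3000) 100 _ (J m)) =>
  [||s3 [st3 [x3 [S3 F3 _]]]].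
- by lia.
- have -> : [::] = flatten [seq ([::] : seq int) | _ <- iota 0 m].
    by elim: (iota _ _).
  apply: runs_weaken (runs_for (N := m) (T := 2800) (J := J) _ _ J2) _ _ => //.
  + move=> k s3 km [st3 [x3 [S3 F3 x3n]]]; rewrite !evalE (stores_O S3) inp1.
    split; first by lia.
    apply: runs_loop_free_le => //.
    rewrite /p_give run_block.
    set s4 := run inp (IfLe _ _ _ _) s3.
    have [st4 [x4 [S4 F4 x4n]]] : exists st4 x4,
        [/\ stores s4 st4 k x4 l, filling n m V (own st4) k.+1 x4 & (x4 < n)%N].
      rewrite /s4 run_if !evalE inp0 (stores_O S3) (stores_own S3).
      rewrite lez_nat; case: leqP => ownk; rewrite ?run_skip; last first.
        by exists st3, x3; split=> //; exact: filling_skip.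
      have own_n : own st3 k = n by have := fill_le F3 km; lia.
      have F4 := filling_give F3 km own_n x3n.
      rewrite run_block run_set_arr !evalE (stores_O S3) (stores_X S3).
      have S4 := stores_set_own k x3 S3.
      rewrite run_block run_set_reg !evalE (stores_X S4) -PoszD addn1.
      have S5 := stores_set_X x3.+1 S4.
      rewrite run_block run_if !evalE (stores_X S5) inp0 run_nil run_set_reg
        !evalE run_skip.
      rewrite lez_nat; move: F4; case: leqP => nx F4.
        by eexists; exists 0%N; split; [exact: stores_set_X S5| |].
      by eexists; exists x3.+1; split; [exact: S5| |].
    rewrite run_block run_set_reg !evalE (stores_O S4) run_nil -PoszD addn1.
    by exists st4, x4; split=> //; exact: stores_set_O S4.
  + by move=> s3 [st3 [x3 [S3 _ _]]]; rewrite !evalE (stores_O S3) inp1; lia.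
  + by rewrite leq_mul2l orbC.
by apply: runs_loop_free_le => //; exists st3, m, x3, x3.
Qed.

Lemma runs_print_item s st i o l : stores s st o i l ->
  runs inp p_print_item s 1000 [:: Posz (own st o == i)]
    (fun s' => stores s' st o.+1 i l).
Proof.
move=> S; pose Q (s' : memory) := s' = s.
apply: (@runs_seq_then_silent _ _ _ _ 500 500 _ _ Q) => //; last first.
  move=> _ ->; apply: runs_loop_free_le => //.
  rewrite run_seq run_skip run_set_reg !evalE (stores_O S) -PoszD addn1.
  exact: stores_set_O S.
apply: (@runs_if_le _ _ _ _ _ _ 300) => //;
  rewrite !evalE (stores_O S) (stores_own S) (stores_X S).
  rewrite lez_nat => oi; apply: (@runs_if_le _ _ _ _ _ _ 100) => //.
    rewrite !evalE (stores_O S) (stores_own S) (stores_X S) lez_nat => io.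
    by rewrite (_ : own st o == i); [exact: runs_write|rewrite eqn_leq oi].
  rewrite !evalE (stores_O S) (stores_own S) (stores_X S) ltz_nat => io.
  by rewrite ltn_eqF //; exact: runs_write.
by rewrite ltz_nat => io; rewrite gtn_eqF //; exact: runs_write.
Qed.

Definition T_print := (n.+1 * (m.+1 * 2000 + 2000) + 1000)%N.

Lemma runs_print s st o x l : stores s st o x l ->
  runs inp p_print s T_print
    (flatten [seq flatten [seq [:: Posz (own st o == i)] | o <- iota 0 m]
      | i <- iota 0 n])
    (fun=> True).
Proof.
move=> S; pose J k s := exists o, stores s st o k l.
apply: (@runs_seq_silent _ _ _ _ 500 (n.+1 * (m.+1 * 2000 + 2000) + 500)
  _ (J 0%N)) => [||s1 J1].
- by rewrite /T_print; lia.
- apply: runs_loop_free_le => //; rewrite run_set_reg !evalE.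
  by exists o; exact: stores_set_X S.
apply: (@runs_seq_then_silent _ _ _ _ (n.+1 * (m.+1 * 2000 + 2000)) 500
  _ _ (J n)) => //; last first.
  by move=> s2 _; exact: runs_loop_free_le.
apply: runs_weaken (runs_for (N := n) (T := m.+1 * 2000 + 1000) (J := J)
  _ _ J1) _ _ => //.
- move=> i s2 i_n [o2 S2]; rewrite !evalE (stores_X S2) inp0; split;
  first by lia.
  apply: (@runs_seq_silent _ _ _ _ 300 (m.+1 * 2000 + 500) _
    (fun s3 => stores s3 st 0 i l)) => [||s3 S3].
  + by lia.
  + apply: runs_loop_free_le => //; rewrite run_set_reg !evalE.
    exact: stores_set_O S2.
  pose K k s := stores s st k i l.
  apply: (@runs_seq_then_silent _ _ _ _ (m.+1 * 2000) 500 _ _ (K m)) => //;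
    last first.
    move=> s4 S4; apply: runs_loop_free_le => //.
    rewrite run_seq run_skip run_set_reg !evalE (stores_X S4) -PoszD addn1.
    by exists m; exact: stores_set_X S4.
  apply: runs_weaken (runs_for (N := m) (T := 1000) (J := K) _ _ S3) _ _ => //.
  + move=> k s4 km S4; rewrite !evalE (stores_O S4) inp1; split; first by lia.
    exact: runs_print_item.
  + by move=> s4 S4; rewrite !evalE (stores_O S4) inp1; lia.
  + by rewrite leq_mul2l orbC.
- by move=> s2 [o2 S2]; rewrite !evalE (stores_X S2) inp0; lia.
- by rewrite leq_mul2l; apply/orP; right; rewrite /=; lia.
Qed.

Definition T_main := (T_init + (T_search + (T_fill + (T_print + 100))) + 100)%N.

Lemma exec_main : (0 < n)%N -> (0 < m)%N -> c = \sum_(o < m) inp`_(2 + o) ->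
  (forall i, (i < n)%N -> \sum_(o < m) inp`_(2 + i * m + o) = c) ->
  exists ow t s, [/\ exec inp p_main (fun=> 0) t s
      (flatten [seq flatten [seq [:: Posz (ow o == i)] | o <- iota 0 m]
        | i <- iota 0 n]),
    (t <= T_main)%N,
    forall o, (o < m)%N -> (ow o < n)%N &
    exists b : int, forall i, (i < n)%N ->
      b <= \sum_(o < m | ow o == i) inp`_(2 + i * m + o) <= b + 1].
Proof.
move=> n_gt0 m_gt0 cE total.
(* After the flip of signs the common total is nonnegative, as [quiet_universal] requires. *)
have totalV i : (i < n)%N -> \sum_(o < m) V i o = `|c|.
  move=> i_n; rewrite -[in RHS](total i i_n) /V (ltn_eqF i_n).
  case: leP => c0; first by rewrite total // ger0_norm.
  by rewrite sumrN total // ltr0_norm.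
have [t1 [s1 [ex1 le1 [ow1 [S1 ow1_n]]]]] := runs_init.
rewrite -cE in S1.
have [t2 [s2 [ex2 le2 [st2 [o2 [x2 [l2 [S2 I2 q2]]]]]]]] :=
  runs_search (inv_start ow1_n) S1 (isT : (0 < clock (start ow1))%N).
have F2 := filling_start V_bound V_pool I2 (normr_ge0 c) totalV q2.
have [t3 [s3 [ex3 le3 [st3 [o3 [x3 [x [S3 F3]]]]]]]] := runs_fill n_gt0 S2 F2.
have [t4 [s4 [ex4 le4 _]]] := runs_print S3.
have := ExecSeq ex1 (ExecSeq ex2 (ExecSeq ex3 (ExecSeq ex4 (ExecSkip _ _)))).
rewrite cats0 !cat0s => ex.
exists (own st3); eexists; exists s4; split.
- by apply: ExecIfTrue ex; rewrite !evalE inp1; lia.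
- by rewrite /T_main /=; lia.
- by move=> o om; exact: (fill_done F3).
have [b bE] := fill_balanced F3; case: (leP 0 c) => c0.
  exists b => i i_n; have := bE i i_n.
  by rewrite /worth /V (ltn_eqF i_n) c0.
(* Undoing the flip maps the range from [b] to [b + 1] to the one from [- b - 1] to [- b]. *)
exists (- b - 1) => i i_n; have := bE i i_n.
by rewrite /worth /V (ltn_eqF i_n) [0 <= c]leNgt c0 /= sumrN;
  move: (\sum_(_ < _ | _) _); lia.
Qed.

End Program.

(** * Instances and their encodings *)

Section Bound.

Lemma leq_add_pow M k a b : (1 < M)%N ->
  (a <= M ^ k -> b <= M ^ k -> a + b <= M ^ k.+1)%N.
Proof. by move=> M2 aM bM; rewrite expnS -[leqLHS]mul1n; nia. Qed.

Lemma leq_mul_pow M k l a b :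
  (a <= M ^ k -> b <= M ^ l -> a * b <= M ^ (k + l))%N.
Proof. by move=> *; rewrite expnD leq_mul. Qed.

(** All quantities are compared with powers of [M]: a product adds the exponents, a sum raises them
    by one, and constants up to 10000 fit below [M ^ 2]. *)
Lemma T_main_le n m L : (n <= L)%N -> (m <= L)%N ->
  (T_main n m <= (L + 100) ^ 22)%N.
Proof.
move=> nL mL; set M := (L + 100)%N.
have M1 : (1 < M)%N by rewrite /M; lia.
have up k l a : (a <= M ^ k -> k <= l -> a <= M ^ l)%N.
  by move=> aM kl; apply: leq_trans aM _; rewrite leq_exp2l.
have cst a : (a <= 100 * 100 -> a <= M ^ 2)%N.
  by move/leq_trans; apply; rewrite -mulnn leq_mul // /M leq_addl.
have cst1 a : (a <= 100 -> a <= M ^ 1)%N.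
  by move/leq_trans; apply; rewrite expn1 /M leq_addl.
have n1 : (n.+1 <= M ^ 1)%N by rewrite expn1 /M; lia.
have m1 : (m.+1 <= M ^ 1)%N by rewrite expn1 /M; lia.
have n2 : (n + 2 <= M ^ 1)%N by rewrite expn1 /M; lia.
have B : ((budget n m).+1 <= M ^ 4)%N.
  rewrite /budget -addn1 -!addnA; apply: leq_add_pow => //.
    by rewrite -mulnn; apply: (@leq_mul_pow _ 1 2);
      [exact: ltnW|exact: (@leq_mul_pow _ 1 1)].
  by apply: (up 1%N) => //; rewrite expn1 /M; lia.
have W : (T_walk n m <= M ^ 6)%N by apply: (@leq_mul_pow _ 4 2) => //;
  exact: cst.
have C : (T_check n m <= M ^ 8)%N.
  apply: leq_add_pow => //; last by apply: (up 2%N) => //; exact: cst.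
  by apply: leq_add_pow => //; apply: (up 2%N) => //; exact: cst.
have R : (T_row n m <= M ^ 11)%N.
  apply: leq_add_pow => //; last by apply: (up 2%N) => //; exact: cst.
  apply: (@leq_mul_pow _ 1 9) => //; apply: leq_add_pow => //.
  by apply: (up 2%N) => //; exact: cst.
have S : (T_scan n m <= M ^ 14)%N.
  apply: leq_add_pow => //; last by apply: (up 2%N) => //; exact: cst.
  apply: (@leq_mul_pow _ 1 12) => //; apply: leq_add_pow => //.
  by apply: (up 2%N) => //; exact: cst.
have Q : (T_search n m <= M ^ 19)%N.
  apply: (@leq_mul_pow _ 4 15) => //; apply: leq_add_pow => //.
  by apply: (up 2%N) => //; exact: cst.
have init : (T_init n m <= M ^ 5)%N.
  apply: leq_add_pow => //; last by apply: (up 2%N) => //; exact: cst.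
  by apply: leq_add_pow => //; apply: (@leq_mul_pow _ 1 2) => //; exact: cst.
have fill : (T_fill m <= M ^ 4)%N.
  apply: leq_add_pow => //; last by apply: (up 2%N) => //; exact: cst.
  by apply: (@leq_mul_pow _ 1 2) => //; exact: cst.
have print : (T_print n m <= M ^ 6)%N.
  apply: leq_add_pow => //; last by apply: (up 2%N) => //; exact: cst.
  apply: (@leq_mul_pow _ 1 4) => //; apply: leq_add_pow => //.
    by apply: (@leq_mul_pow _ 1 2) => //; exact: cst.
  by apply: (up 2%N) => //; exact: cst.
have c1 : (100 <= M ^ 1)%N by exact: cst1.
(* The search dominates with exponent 19, and three nested additions lead to 22. *)
apply: leq_add_pow => //; last by apply: (up 1%N).
apply: leq_add_pow => //; first exact: (up 5).
apply: leq_add_pow => //; apply: (up 8) => //.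
apply: leq_add_pow => //; first exact: (up 4).
by apply: leq_add_pow => //; apply: (up 1%N).
Qed.

End Bound.

(** * From owner functions to allocations *)

Section Glue.
Local Open Scope ring_scope.

Lemma nth_flatten_uniform T (x0 : T) (ss : seq (seq T)) m i o :
  all (fun s => size s == m) ss -> (i < size ss)%N -> (o < m)%N ->
  nth x0 (flatten ss) (i * m + o) = nth x0 (nth [::] ss i) o.
Proof.
elim: ss i => // s ss IH [|i] /= /andP[/eqP sz all_ss] i_lt om.
  by rewrite mul0n add0n nth_cat sz om.
by rewrite nth_cat sz mulSn -addnA ltnNge leq_addr /= addKn IH.
Qed.

Lemma encode_instance_entry (I : instance) (i : 'I_(agents I))
    (o : 'I_(items I)) :
  (encode_instance I)`_(2 + i * items I + o) = valuation i [set o].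
Proof.
rewrite /encode_instance -addnA /= nth_flatten_uniform //; last first.
- by rewrite size_map size_enum_ord.
- by apply/allP => s /mapP[j _ ->]; rewrite size_map size_enum_ord.
rewrite (nth_map i) ?size_enum_ord // nth_ord_enum.
by rewrite (nth_map o) ?size_enum_ord // nth_ord_enum.
Qed.

Definition bundles_of (I : instance) (ow : nat -> nat) : bundles I :=
  [ffun i : 'I_(agents I) => [set o : 'I_(items I) | ow o == i]].

Lemma encode_bundles_of (I : instance) ow :
  encode_bundles (bundles_of I ow) =
    flatten [seq flatten [seq [:: Posz (ow o == i)] | o <- iota 0 (items I)]
            | i <- iota 0 (agents I)].
Proof.
rewrite /encode_bundles -!val_enum_ord -[in RHS]map_comp; congr flatten.
apply: eq_map => i /=; rewrite -map_comp.
elim: (enum 'I_(items I)) => //= o s ->.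
by rewrite ffunE inE.
Qed.

Lemma complete_bundles_of (I : instance) ow :
  (forall o, (o < items I)%N -> (ow o < agents I)%N) ->
  complete_allocation (bundles_of I ow).
Proof.
move=> ow_lt; split=> [i j ij|].
  rewrite -setI_eq0; apply/eqP/setP => o; rewrite !ffunE !inE.
  by apply/negbTE/andP => -[/eqP-> /eqP/val_inj e]; rewrite e eqxx in ij.
apply/setP => o; rewrite inE; apply/bigcupP.
by exists (Ordinal (ow_lt o (ltn_ord o))) => //; rewrite ffunE inE.
Qed.

(* If two values differ by one, then the larger is positive, hence comes with
   an item worth 1, or the smaller is negative, hence comes with one worth -1. *)
Lemma balanced_EQ1 (I : instance) (A : bundles I) (b : int) :
  additive_valuations I -> symmetric_trivalued I ->
  (forall i, b <= valuation i (A i) <= b + 1) -> EQ1 A.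
Proof.
move=> add tri bal v i j lt_ij.
have rem k o : o \in A k -> v k (A k :\ o) = v k (A k) - v k [set o].
  move=> oA; rewrite /v !(add k (A k)) (big_setD1 o) //= add.
  by rewrite [X in X - _]addrC addrK.
have [bi bj] := (bal i, bal j).
have [pos|neg] := ltrP 0 (v j (A j)).
  left; have /exists_inP[g gA vg] : [exists (g | g \in A j), 0 < v j [set g]].
    apply: contraLR pos; rewrite -leNgt => /exists_inPn none.
    by rewrite /v add sumr_le0 // => o /none; rewrite -leNgt.
  exists g; split=> //; first exact: ltW.
  by rewrite rem //; move: lt_ij vg bi bj; rewrite /v; lia.
right; have /exists_inP[g gA vg] : [exists (g | g \in A i), v i [set g] < 0].
  have : v i (A i) < 0 by exact: lt_le_trans neg.
  apply: contraLR; rewrite -leNgt => /exists_inPn none.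
  by rewrite /v add sumr_ge0 // => o /none; rewrite -leNgt.
exists g; split=> //; first exact: ltW.
by rewrite rem //; move: lt_ij vg bi bj; rewrite /v; lia.
Qed.

(** Every integer, even 0, is charged at least one bit. *)
Lemma bit_size_ge (w : seq int) : (size w <= bit_size w)%N.
Proof.
rewrite /bit_size -sum1_size; apply: leq_sum => z _; exact: ltn0Sn.
Qed.

Lemma size_encode_instance I :
  size (encode_instance I) = (2 + agents I * items I)%N.
Proof. by rewrite /= size_allpairs !size_enum_ord. Qed.

Lemma main_correct (I : instance) :
  (0 < agents I)%N -> additive_valuations I -> symmetric_trivalued I ->
  normalized I ->
  exists (A : bundles I) t s, [/\ complete_allocation A /\ EQ1 A,
    exec (encode_instance I) p_main (fun=> 0) t s (encode_bundles A) &
    (t <= (bit_size (encode_instance I) + 100) ^ 22)%N].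
Proof.
move=> n_gt0 add tri [c norm].
set inp := encode_instance I.
have [m0|m_gt0] := posnP (items I).
  (* Without items any owner function yields the empty bundles, and the program halts at once with
     no output. *)
  exists (bundles_of I (fun=> 0%N)); eexists; exists (fun=> 0).
  rewrite encode_bundles_of m0.
  have -> : flatten [seq flatten [seq [:: Posz (0%N == i)] | o <- iota 0 0]
              | i <- iota 0 (agents I)] = [::] by elim: (iota 0 (agents I)).
  have empty i : bundles_of I (fun=> 0%N) i = set0.
    by apply/setP => o; suff : (o < 0)%N by []; rewrite -m0.
  split; first split.
  - by apply: complete_bundles_of => o; rewrite m0.
  - apply: (@balanced_EQ1 _ _ 0) => // i.
    by rewrite empty add big_set0.
  - by apply: ExecIfFalse; [rewrite /= m0|exact: ExecSkip].
  - apply: (@leq_trans (100 ^ 22)); last by rewrite leq_exp2r // leq_addl.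
    by apply: (@leq_trans (100 ^ 1)) => //; rewrite leq_exp2l.
have inp_entry (i : 'I_(agents I)) (o : 'I_(items I)) :
    inp`_(2 + i * items I + o) = valuation i [set o] by exact:
      encode_instance_entry.
have total i : (i < agents I)%N ->
  \sum_(o < items I) inp`_(2 + i * items I + o) = c.
  move=> i_n; rewrite -(norm (Ordinal i_n)) add.
  by apply: eq_big => [o|o _]; [rewrite inE|rewrite -inp_entry].
have bound i o : (i < agents I)%N -> (o < items I)%N ->
    -1 <= (if i == agents I then -1
           else if 0 <= c then inp`_(2 + i * items I + o)
                else - inp`_(2 + i * items I + o)) <= 1.
  move=> i_n om; rewrite ltn_eqF // (inp_entry (Ordinal i_n) (Ordinal om)).
  have := tri (Ordinal i_n) (Ordinal om); rewrite !inE.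
  by case/or3P => /eqP ->; case: ifP.
have cE : c = \sum_(o < items I) inp`_(2 + o).
  by rewrite -(total 0%N n_gt0); apply: eq_bigr => o _; rewrite mul0n addn0.
have [ow [t [s [ex le_t ow_lt [b bal]]]]] :=
  exec_main (erefl : inp`_0 = agents I) (erefl :
    inp`_1 = items I) bound n_gt0 m_gt0 cE total.
exists (bundles_of I ow), t, s; split; last 1 first.
(* Both dimensions are positive, so each is at most their product, hence at most the length of the
   encoding. *)
- apply: leq_trans le_t (T_main_le _ _).
    apply: leq_trans (bit_size_ge _); rewrite size_encode_instance.
    by apply: leq_trans (leq_addl _ _); rewrite leq_pmulr.
  apply: leq_trans (bit_size_ge _); rewrite size_encode_instance.
  by apply: leq_trans (leq_addl _ _); rewrite leq_pmull.
- split; first exact: complete_bundles_of.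
  apply: (@balanced_EQ1 _ _ b) => // i; rewrite add.
  rewrite (eq_bigl (fun o : 'I__ => ow o == i)); last by move=> o;
    rewrite ffunE inE.
  by under eq_bigr => o _ do rewrite -inp_entry; exact: bal.
by rewrite encode_bundles_of.
Qed.

End Glue.

Theorem theorem4p3 :
  (forall I : instance,
     (0 < agents I)%N -> additive_valuations I -> symmetric_trivalued I ->
     normalized I ->
     exists A : bundles I, complete_allocation A /\ EQ1 A) /\
  poly_time_solvable
    (fun I : instance =>
       [/\ (0 < agents I)%N, additive_valuations I, symmetric_trivalued I
         & normalized I])
    encode_instance encode_bundles
    (fun (I : instance) (A : bundles I) => complete_allocation A /\ EQ1 A).
Proof.
split=> [I n_gt0 add tri norm|].
  by have [A [_ [_ [AP _ _]]]] := main_correct n_gt0 add tri norm; exists A.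
exists p_main, (('X + (100%N)%:P) ^+ 22)%R => I [n_gt0 add tri norm].
have [A [t [s [AP ex le_t]]]] := main_correct n_gt0 add tri norm.
by exists A, t, s; split=> //;
  rewrite horner_exp hornerD hornerX hornerC natrXE.
Qed.
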